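(* Let $(M,\tau)$ be a tracial von Neumann algebra with finite subset $X=X^*\subset M$. If $\sigma(\mathbb{C}\langle X\rangle,\tau)=|X|$, then \[ \sigma(\mathbb{C}\langle X\cup Y\rangle,\tau)\leq |X|=\sigma(\mathbb{C}\langle X\rangle,\tau) \] for any finite subset $Y=Y^*\subset\mathrm{dom}(\overline{\partial_X})\cap\mathbb{C}\langle X\rangle''$.
   Context: A tracial von Neumann algebra $(M,\tau)$ is a finite von Neumann algebra $M$ with a faithful normal tracial state $\tau$. For $X=X^*\subset M$ finite, $\mathbb{C}\langle X\rangle$ is the unital $*$-algebra generated by $X$. $M^\circ$ is the opposite algebra with trace $\tau^\circ$, and $M\bar\otimes M^\circ$ carries the trace $\tau\otimes\tau^\circ$. For a unital $*$-subalgebra $A\subset M$, $L^2(A\otimes A^\circ,\tau\otimes\tau^\circ)$ is the closure of $A\otimes A^\circ$ in $L^2(M\bar\otimes M^\circ,\tau\otimes\tau^\circ)$ and $(A\otimes A^\circ)''$ is the von Neumann algebra generated by $A\otimes A^\circ$. This Hilbert space is an $A$-$A$ bimodule via $x\cdot\xi\cdot y=(x\otimes y^\circ)\xi$, and has the commuting right action of $(A\otimes A^\circ)''$ by right multiplication. A derivation is a linear map $\delta\colon A\to L^2(A\otimes A^\circ,\tau\otimes\tau^\circ)$ with $\delta(xy)=x\cdot\delta(y)+\delta(x)\cdot y$. $\mathrm{Der}_{1\otimes1}(A,\tau)$ is the space of derivations $\delta$ such that $1\otimes1\in\mathrm{dom}(\delta^* )$, where $\delta$ is viewed as a densely defined operator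 $L^2(A,\tau)\to L^2(A\otimes A^\circ,\tau\otimes\tau^\circ)$. If $Z=Z^*$ is a finite generating set of the unital $*$-algebra $A$, then $\phi_Z(\delta)=(\delta(z))_{z\in Z}$ is an injective right $(A\otimes A^\circ)''$-linear map with closed range from the space of all derivations on $A$ into $L^2(A\otimes A^\circ,\tau\otimes\tau^\circ)^Z$, giving the norm $\|\delta\|_Z=(\sum_{z\in Z}\|\delta(z)\|^2)^{1/2}$; the topology is independent of $Z$, and closures are taken in it. The free Stein dimension is \[\sigma(A,\tau)=\dim\overline{\mathrm{Der}_{1\otimes1}(A,\tau)}_{(A\otimes A^\circ)''},\] the von Neumann dimension (with respect to $\tau\otimes\tau^\circ$) of the right Hilbert $(A\otimes A^\circ)''$-module $\phi_Z\big(\overline{\mathrm{Der}_{1\otimes1}(A,\tau)}\big)\subset L^2(A\otimes A^\circ,\tau\otimes\tau^\circ)^Z$; it does not depend on $Z$. Free gradient: let $T_X=\{t_x : x\in X\}$ be formal variables with $t_x^*=t_{x^*}$, let $\mathbb{C}\langle T_X\rangle$ be the $*$-algebra of noncommutative polynomials in them, and for $p\in\mathbb{C}\langle T_X\rangle$ let $p(X)$ denote evaluation at $t_x=x$. The free difference quotients $\partial_x\colon\mathbb{C}\langle T_X\rangle\to\mathbb{C}\langle T_X\rangle\otimes\mathbb{C}\langle T_X\rangle^\circ$ are the derivations with $\partial_x(t_y)=\delta_{x=y}1\otimes1$, and $\partial_X p=(\partial_x p)_{x\in X}$. $\partial_X$ is viewed as the densely defined relation $\{(p(X),((\partial_xp)(X))_{x\in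 X}) : p\in\mathbb{C}\langle T_X\rangle\}$ from $L^2(\mathbb{C}\langle X\rangle,\tau)$ to $L^2(\mathbb{C}\langle X\rangle\otimes\mathbb{C}\langle X\rangle^\circ,\tau\otimes\tau^\circ)^X$. When $\sigma(\mathbb{C}\langle X\rangle,\tau)=|X|$ this is known to be the graph of a closable operator, and $\overline{\partial_X}$ denotes its closure. *)

(* Defs.v *)
From HB Require Import structures.
From mathcomp Require Import all_boot all_order all_algebra complex finmap.
From mathcomp Require Import boolp classical_sets reals topology normedtype.
From mathcomp Require Import -(notations) monalg.

Set Implicit Arguments.
Unset Strict Implicit.
Unset Printing Implicit Defensive.

Import Order.TTheory GRing.Theory Num.Theory.
Import numFieldNormedType.Exports.

Local Open Scope classical_set_scope.
Local Open Scope ring_scope.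

(* The inner product [ip] is linear in its first variable and conjugate-linear
   in the second one. *)
Record hilbertType (R : realType) := HilbertType {
  hilbert_sort :> completeNormedModType R[i];
  ip : {dot hilbert_sort for Num.conj};
  ip_norm : forall u : hilbert_sort, ip u u = `|u| ^+ 2
}.

Arguments ip {R h}.

Section Operators.
Context {R : realType} {H : hilbertType R}.

Definition bounded_op (T : H -> H) : Prop := linear T /\ continuous T.

Definition commutant (S : set (H -> H)) : set (H -> H) :=
  [set T | bounded_op T /\ forall U, S U -> T \o U = U \o T].

End Operators.

Definition linear_span (K : nzRingType) (V : lmodType K) (S : set V) : set V :=
  [set v | exists (n : nat) (c : 'I_n -> K) (s : 'I_n -> V),
     (forall i, S (s i)) /\ v = \sum_(i < n) c i *: s i].

(* A von Neumann algebra is given as a unital complex algebra [vna_sort] with an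
   adjoint operation [star], together with a faithful unital *-representation
   [vna_act] on a Hilbert space whose range equals its bicommutant.  That [star]
   is a conjugate-linear anti-multiplicative involution follows from [act_star]
   and [act_inj].  Finiteness of the algebra follows from the existence of the
   faithful trace.  In [tr_normal], [le] is the order of the positive cone
   {z^* z}, and directed sets of self-adjoint elements play the role of bounded
   increasing nets. *)
Record tracial_vna (R : realType) := TracialVNA {
  vna_sort :> algType R[i];
  star : vna_sort -> vna_sort;
  vna_space : hilbertType R;
  vna_act : vna_sort -> vna_space -> vna_space;
  act_bounded : forall a, bounded_op (vna_act a);
  act_linear : forall (c : R[i]) a b u,
    vna_act (c *: a + b) u = c *: vna_act a u + vna_act b u;
  act_mul : forall a b u, vna_act (a * b) u = vna_act a (vna_act b u);
  act_one : forall u, vna_act 1 u = u;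
  act_star : forall a u v, ip (vna_act a u) v = ip u (vna_act (star a) v);
  act_inj : injective vna_act;
  act_bicommutant : commutant (commutant (range vna_act)) = range vna_act;
  tr : {scalar vna_sort};
  tr_one : tr 1 = 1;
  tr_ge0 : forall a, 0 <= tr (star a * a);
  tr_faithful : forall a, tr (star a * a) = 0 -> a = 0;
  tr_trace : forall a b, tr (a * b) = tr (b * a);
  tr_normal :
    let le a b := exists z, b - a = star z * z in
    forall (D : set vna_sort) (s : vna_sort),
      D !=set0 ->
      (forall a, D a -> star a = a) ->
      (forall a b, D a -> D b -> exists c, [/\ D c, le a c & le b c]) ->
      (forall a, D a -> le a s) ->
      (forall t, (forall a, D a -> le a t) -> le s t) ->
      forall e : R[i], 0 < e -> exists2 a, D a & tr s < tr a + e
}.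

Arguments star {R t}.
Arguments vna_act {R t}.
Arguments tr {R t}.

(* L^2(M, tau): the completion of M for <a, b> = tau(b^* a). *)
Record L2_space (R : realType) (M : tracial_vna R) := L2Space {
  L2_sort :> hilbertType R;
  vec : {linear M -> L2_sort};
  vec_ip : forall a b, ip (vec a) (vec b) = tr (star b * a);
  vec_dense : closure (range vec) = setT
}.

Arguments vec {R M l}.

(* L^2(M (x) M^o, tau (x) tau^o), the Hilbert space of the von Neumann tensor
   product, as the completion of the algebraic tensor product.  [tens a b] is
   a (x) b^o, so that the inner product of a (x) b^o and c (x) d^o is
   tau(c^* a) tau^o((d^o)^* b^o) = tau(c^* a) tau(b d^* ), and [lmult x y] is left
   multiplication by x (x) y^o, for which y^o d^o = (d y)^o. *)
Record L2_tensor (R : realType) (M : tracial_vna R) := L2Tensor {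
  L2t_sort :> hilbertType R;
  tens : {bilinear M -> M -> L2t_sort};
  tens_ip : forall a b c d,
    ip (tens a b) (tens c d) = tr (star c * a) * tr (b * star d);
  tens_dense : closure (linear_span [set tens p.1 p.2 | p in setT]) = setT;
  lmult : M -> M -> L2t_sort -> L2t_sort;
  lmult_bounded : forall x y, bounded_op (lmult x y);
  lmult_tens : forall x y a b, lmult x y (tens a b) = tens (x * a) (b * y)
}.

Arguments tens {R M l}.
Arguments lmult {R M l}.

Section Subalgebras.
Context {R : realType} {M : tracial_vna R}.

Definition unital_star_subalgebra (A : set M) : Prop :=
  [/\ A 1,
      forall (c : R[i]) a b, A a -> A b -> A (c *: a + b),
      forall a b, A a -> A b -> A (a * b) &
      forall a, A a -> A (star a)].

(* C<X> *)
Definition gen_alg (X : {fset M}) : set M :=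
  \bigcap_(A in [set A | unital_star_subalgebra A /\ [set` X] `<=` A]) A.

(* C<X>'' *)
Definition gen_vna (X : {fset M}) : set M :=
  [set m | commutant (commutant (vna_act @` gen_alg X)) (vna_act m)].

Definition selfadjoint_fset (X : {fset M}) : Prop :=
  [fset star x | x in X]%fset = X.

End Subalgebras.

(* Finite powers K^Z of a Hilbert space, as functions on a finite type. *)
Section HilbertPower.
Context {R : realType} {K : hilbertType R} {Z : finType}.
Implicit Types (xi eta : Z -> K) (V : set (Z -> K)).

Definition pow_ip xi eta : R[i] := \sum_(z : Z) ip (xi z) (eta z).

Definition pow_norm xi : R[i] := sqrtC (\sum_(z : Z) `|xi z| ^+ 2).

(* The orthogonal projection of xi on V; it is the unique such point when V is a
   closed subspace. *)
Definition orth_proj V xi : Z -> K :=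
  xget (fun=> 0) [set p | V p /\ forall w, V w -> pow_ip (xi \- p) w = 0].

End HilbertPower.

Section FreeSteinDimension.
Context {R : realType} {M : tracial_vna R}.
Variables (L : L2_space M) (K : L2_tensor M).
Implicit Types (A : set M) (Z : {fset M}) (delta : M -> K).

(* L^2(A, tau) *)
Definition L2_alg A : set L := closure (vec @` A).

(* L^2(A (x) A^o, tau (x) tau^o) *)
Definition L2_alg_tensor A : set K :=
  closure (linear_span [set tens p.1 p.2 | p in A `*` A]).

(* A derivation on A is represented by a function on M of which only the
   restriction to A is relevant. *)
Definition derivation A delta : Prop :=
  [/\ forall a, A a -> L2_alg_tensor A (delta a),
      forall (c : R[i]) a b, A a -> A b ->
        delta (c *: a + b) = c *: delta a + delta b &
      forall a b, A a -> A b ->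
        delta (a * b) = lmult a 1 (delta b) + lmult 1 b (delta a)].

(* The domain of delta^*, for delta seen as a densely defined operator from
   L^2(A, tau) to L^2(A (x) A^o, tau (x) tau^o). *)
Definition dom_adjoint A delta : set K :=
  [set eta | L2_alg_tensor A eta /\
     exists2 xi : L, L2_alg A xi &
       forall a, A a -> ip (delta a) eta = ip (vec a : L) xi].

Definition Der11 A : set (M -> K) :=
  [set delta | derivation A delta /\ dom_adjoint A delta (tens 1 1)].

Definition phi Z delta : Z -> K := fun z => delta (val z).
Arguments phi : clear implicits.

(* The closure of Der11 A in the space of derivations on A, for the norm
   || delta ||_Z = || phi Z delta ||. *)
Definition Der11_closure A Z : set (M -> K) :=
  [set delta | derivation A delta /\
     forall e : R[i], 0 < e ->
       exists2 delta', Der11 A delta' &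
         pow_norm (phi Z delta \- phi Z delta') < e].

Definition unit_vec Z (z : Z) : Z -> K :=
  fun z' => if z' == z then tens 1 1 else 0.

(* For N = (A (x) A^o)'', a closed right N-submodule V of
   L^2(N)^Z = L^2(A (x) A^o)^Z is the range of a projection P in Mat_Z(N), and its
   von Neumann dimension is the trace of P, i.e. the sum over z of
   (tau (x) tau^o)(P_zz) = < P e_z, e_z > with e_z = [unit_vec z]. *)
Definition vn_dim Z (V : set (Z -> K)) : R :=
  complex.Re (\sum_(z : Z) pow_ip (orth_proj V (unit_vec z)) (unit_vec z)).

(* sigma(A, tau), computed from a finite self-adjoint generating set Z of A; the
   value does not depend on Z. *)
Definition free_stein_dim A Z : R :=
  vn_dim (phi Z @` Der11_closure A Z).

End FreeSteinDimension.

(* The free algebra C<t_x : x in T>, with basis the words in T. *)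
Notation free_alg R T := (malg (fmonom T) (complex R)).

(* C<T> (x) C<T>^o, with basis the u (x) v^o for u, v words in T. *)
Notation free_tens R T := (malg (fmonom T * fmonom T)%type (complex R)).

(* The linear extension of h : J -> V to the vector space with basis J. *)
Definition lin_ext (R : realType) (J : choiceType) (V : lmodType R[i])
    (h : J -> V) (p : malg J R[i]) : V :=
  \sum_(k <- msupp p) mcoeff k p *: h k.

Section FreeDifferenceQuotients.
Context {R : realType} {T : choiceType}.
Implicit Types (x y : T) (u v w : fmonom T).
Implicit Types (p q : free_alg R T) (s : free_tens R T).

Definition gen x : free_alg R T := mkmalgU (FMonom [:: x]) 1.

Definition tens_word u v : free_tens R T := mkmalgU (u, v) 1.

(* del_x (t_{x_1} ... t_{x_n}) is the sum over the i with x_i = x of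
   t_{x_1} ... t_{x_{i-1}} (x) (t_{x_{i+1}} ... t_{x_n})^o.  By [fdq_gen] and
   [fdq_Leibniz] below, [fdq x] is the derivation with del_x(t_y) equal to
   1 (x) 1 if x = y and to 0 otherwise. *)
Definition fdq_word x w : free_tens R T :=
  \sum_(i < size w | nth x w i == x)
    tens_word (FMonom (take i w)) (FMonom (drop i.+1 w)).

Definition fdq x p : free_tens R T := lin_ext (fdq_word x) p.

(* p . s and s . q, where p . (u (x) v^o) . q = p u (x) (v q)^o *)
Definition free_lmul p s : free_tens R T :=
  lin_ext (fun w => lin_ext (fun k => tens_word (mul w k.1) k.2) s) p.
Definition free_rmul s q : free_tens R T :=
  lin_ext (fun w => lin_ext (fun k => tens_word k.1 (mul k.2 w)) s) q.

End FreeDifferenceQuotients.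

Section FreeDifferenceQuotientsTheory.
Context {R : realType}.

Lemma lin_extEw (J : choiceType) (V : lmodType R[i]) (h : J -> V)
    (d : {fset J}) (p : malg J R[i]) :
  (msupp p `<=` d)%fset -> lin_ext h p = \sum_(k <- d) mcoeff k p *: h k.
Proof.
move=> le; rewrite /lin_ext; apply/big_fset_incl => // k _ kp.
by rewrite mcoeff_outdom ?scale0r.
Qed.

Lemma lin_ext_is_linear (J : choiceType) (V : lmodType R[i]) (h : J -> V) :
  linear (lin_ext h).
Proof.
move=> c p q.
pose d := (msupp p `|` msupp q `|` msupp (c *: p + q))%fset.
have dp : (msupp p `<=` d)%fset by apply/fsubsetP=> k kp; rewrite !inE kp.
have dq : (msupp q `<=` d)%fset by apply/fsubsetP=> k kp; rewrite !inE kp orbT.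
have dr : (msupp (c *: p + q) `<=` d)%fset.
  by apply/fsubsetP=> k kp; rewrite !inE kp orbT.
rewrite (lin_extEw h dp) (lin_extEw h dq) (lin_extEw h dr) scaler_sumr.
rewrite -big_split; apply: eq_bigr => k _ /=.
by rewrite mcoeffD mcoeffZ scalerDl scalerA.
Qed.

HB.instance Definition _ (J : choiceType) (V : lmodType R[i]) (h : J -> V) :=
  GRing.isLinear.Build R[i] (malg J R[i]) V _ (lin_ext h)
    (lin_ext_is_linear h).

Lemma lin_extU (J : choiceType) (V : lmodType R[i]) (h : J -> V) c (k : J) :
  lin_ext h (mkmalgU k c) = c *: h k.
Proof.
rewrite (@lin_extEw _ _ _ [fset k]%fset) ?msuppU_le //.
by rewrite big_seq_fset1 mcoeffUU.
Qed.

Lemma lin_ext_comp (J1 J2 : choiceType) (V : lmodType R[i]) (g : J2 -> V)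
    (h : J1 -> malg J2 R[i]) (p : malg J1 R[i]) :
  lin_ext g (lin_ext h p) = lin_ext (fun k => lin_ext g (h k)) p.
Proof.
by rewrite [in LHS]/(lin_ext h) linear_sum; apply: eq_bigr => k _; rewrite linearZ.
Qed.

Context {T : choiceType}.
Implicit Types (x y : T) (w : fmonom T).
Implicit Types (p q : free_alg R T) (s : free_tens R T).

Lemma fdq_is_linear x : linear (@fdq R T x).
Proof. exact: lin_ext_is_linear. Qed.

Lemma fdq_gen x y :
  fdq x (gen y) = if x == y then tens_word one one else 0 :> free_tens R T.
Proof.
rewrite /fdq lin_extU scale1r /fdq_word /= big_mkcond big_ord_recl big_ord0.
by rewrite /= addr0 eq_sym /one /= fmoneE.
Qed.

Lemma fdq_word_mul x w1 w2 :
  fdq_word x (mul w1 w2) =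
    lin_ext (fun k => tens_word (mul w1 k.1) k.2) (fdq_word x w2) +
    lin_ext (fun k => tens_word k.1 (mul k.2 w2)) (fdq_word x w1)
  :> free_tens R T.
Proof.
rewrite /fdq_word /mul /= !fmmulE /= !linear_sum /= size_cat addrC.
rewrite big_split_ord /=; congr (_ + _).
  apply: eq_big => [i|i _]; first by rewrite nth_cat ltn_ord.
  rewrite lin_extU scale1r /= !fmmulE take_cat ltn_ord drop_cat /=.
  case: ltnP => // wi; have -> : i.+1 = size w1.
    by apply/eqP; rewrite eqn_leq wi ltn_ord.
  by rewrite subnn drop0 drop_size.
apply: eq_big => [i|i _].
  by rewrite nth_cat ltnNge leq_addr /= addKn.
rewrite lin_extU scale1r /= !fmmulE take_cat ltnNge leq_addr /= addKn.
by rewrite -addnS drop_cat ltnNge leq_addr /= addKn.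
Qed.

Lemma fdq_Leibniz x p q :
  fdq x (p * q) = free_lmul p (fdq x q) + free_rmul (fdq x p) q.
Proof.
have -> : free_lmul p (fdq x q) = \sum_(k <- msupp p) \sum_(l <- msupp q)
    (mcoeff k p * mcoeff l q) *:
      lin_ext (fun u => tens_word (mul k u.1) u.2) (fdq_word x l).
  apply: eq_bigr => k _; rewrite /fdq lin_ext_comp scaler_sumr.
  by apply: eq_bigr => l _; rewrite scalerA.
have -> : free_rmul (fdq x p) q = \sum_(k <- msupp p) \sum_(l <- msupp q)
    (mcoeff k p * mcoeff l q) *:
      lin_ext (fun u => tens_word u.1 (mul u.2 l)) (fdq_word x k).
  rewrite exchange_big; apply: eq_bigr => l _.
  rewrite /fdq lin_ext_comp scaler_sumr.
  by apply: eq_bigr => k _; rewrite scalerA mulrC.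
rewrite malgM_def /fgmul /fdq linear_sum -big_split /=; apply: eq_bigr => k _.
rewrite linear_sum -big_split /=; apply: eq_bigr => l _.
by rewrite lin_extU fdq_word_mul scalerDr.
Qed.

End FreeDifferenceQuotientsTheory.

Section FreeGradient.
Context {R : realType} {M : tracial_vna R}.
Variables (L : L2_space M) (K : L2_tensor M) (X : {fset M}).

Definition eval_word (w : fmonom X) : M := \prod_(x <- (w : seq X)) val x.

(* p(X) *)
Definition eval (p : free_alg R X) : M := lin_ext eval_word p.

Definition eval_tens (s : free_tens R X) : K :=
  lin_ext (fun k => tens (eval_word k.1) (eval_word k.2)) s.

Definition free_gradient : set (L * (X -> K)) :=
  [set (vec (eval p), fun x => eval_tens (fdq x p)) | p in setT].

(* Domain of the closure of the relation [free_gradient], i.e. the first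
   projection of its closure in L^2(M) x L^2(M (x) M^o)^X. *)
Definition dom_free_gradient_closure : set L :=
  [set xi | exists eta : X -> K, forall e : R[i], 0 < e ->
     exists2 g, free_gradient g &
       `|g.1 - xi| < e /\ pow_norm (g.2 \- eta) < e].

End FreeGradient.

Arguments dom_free_gradient_closure {R M}.

(* Main.v *)
(* For B = C<X u Y>, let W be the closure of the set of values
   (delta(z))_(z in X u Y) of the derivations delta of B with 1 (x) 1 in the domain
   of the adjoint.  The Leibniz rule puts all of B (x) B^o in that domain, so W is
   invariant under the right action.  For y in the domain of the closed gradient,
   approximating y by some p(X) expresses < delta(y), p (x) q^o > through the
   delta(x), x in X, continuously in delta; hence the projection of W on the
   coordinates in X is injective.  With P the projector on W and Q the one on
   these coordinates, the trace identity
     tr P - tr ((P(1-Q)P)^n P) = tr Q - tr ((Q(1-P)Q)^n Q),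
   where (P(1-Q)P)^n -> 0 on W, gives dim W = tr P <= tr Q = |X|. *)
From HB Require Import structures.
Require Import Defs.
From mathcomp Require Import all_boot all_order all_algebra complex finmap.
From mathcomp Require Import boolp classical_sets reals topology normedtype.
From mathcomp Require Import functions ring lra.
From mathcomp Require Import -(notations) monalg.

Set Implicit Arguments.
Unset Strict Implicit.
Unset Printing Implicit Defensive.

Import Order.TTheory GRing.Theory Num.Theory.
Import numFieldNormedType.Exports.

Local Open Scope classical_set_scope.
Local Open Scope ring_scope.

(** * Complex numbers and semi-inner products *)

(** The usual way to bound dim W is the polar decomposition of the coordinate projection, inside a
    matrix algebra over (B (x) B^o)''. Neither that algebra nor a spectral theorem is built here. An
    element of it is replaced by a map on K^Z that has an adjoint, commutes with right
    multiplication by elementary tensors of B (x) B^o and preserves L^2(B (x) B^o); its trace is the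
    finite sum of its diagonal pairings. Traciality then comes from the conjugation x |-> x^* of
    L^2, and the decay of the powers from alternating projections. Even exponents make both
    remainders sums of squared norms: one tends to 0, the other is only needed to be nonnegative.
    The delicate point in the injectivity is that p(X) -> y does not make delta(p(X)) converge: only
    its pairings with vectors in the domain of delta^* do. Moreover the limit of d_x p(X) is a mere
    L^2 vector, which cannot multiply delta(x); the trace is used to let it appear as one side of an
    inner product instead. *)

Section ComplexNumbers.
Context {R : realType}.
Implicit Types (x y : R[i]) (a b : R).

Definition normc2 x : R := complex.Re x ^+ 2 + complex.Im x ^+ 2.

Lemma ReD x y : complex.Re (x + y) = complex.Re x + complex.Re y.
Proof. by case: x y => ? ? []. Qed.

Lemma ReN x : complex.Re (- x) = - complex.Re x.
Proof. by case: x. Qed.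

Lemma ReB x y : complex.Re (x - y) = complex.Re x - complex.Re y.
Proof. by rewrite ReD ReN. Qed.

Lemma Re_sum (I : Type) (r : seq I) (P : pred I) (F : I -> R[i]) :
  complex.Re (\sum_(i <- r | P i) F i) = \sum_(i <- r | P i) complex.Re (F i).
Proof. exact: (big_morph _ ReD). Qed.

Lemma Re_ge0 x : 0 <= x -> 0 <= complex.Re x.
Proof. by rewrite lecE => /andP[]. Qed.

Lemma Re_le x y : x <= y -> complex.Re x <= complex.Re y.
Proof. by rewrite lecE => /andP[]. Qed.

Lemma ge0_Re x : 0 <= x -> x = (complex.Re x)%:C%C.
Proof. by case: x => a b; rewrite lecE /= => /andP[/eqP -> _]. Qed.

Lemma normc2E x : (normc2 x)%:C%C = `|x| ^+ 2.
Proof. exact: add_Re2_Im2. Qed.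

Lemma normc2_ge0 x : 0 <= normc2 x.
Proof. by rewrite addr_ge0 ?sqr_ge0. Qed.

Lemma normc2_eq0 x : normc2 x = 0 -> x = 0.
Proof.
move=> x0; apply/eqP; rewrite -normr_eq0 -sqrf_eq0 -normc2E x0.
by rewrite eq_complex /= !eqxx.
Qed.

Lemma normc2R a : normc2 a%:C%C = a ^+ 2.
Proof. by rewrite /normc2 /= expr0n addr0. Qed.

Lemma normc2N x : normc2 (- x) = normc2 x.
Proof. by case: x => a b; rewrite /normc2 /= !sqrrN. Qed.

Lemma normc2D x y : normc2 (x + y) <= 2 * normc2 x + 2 * normc2 y.
Proof.
case: x y => a b [c d]; rewrite -subr_ge0 /normc2 /=.
rewrite [leRHS](_ : _ = (a - c) ^+ 2 + (b - d) ^+ 2); last by ring.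
by rewrite addr_ge0 ?sqr_ge0.
Qed.

Lemma eps_real (e : R[i]) : 0 < e -> exists2 a, 0 < a & e = a%:C%C.
Proof.
move=> e0; exists (complex.Re e); last exact/ge0_Re/ltW.
by move: e0; rewrite ltcE => /andP[].
Qed.

Lemma eq0_le_eps x c : (forall e : R[i], 0 < e -> `|x| <= c * e) -> x = 0.
Proof.
move=> xe; apply/eqP; rewrite -normr_eq0; apply/negPn/negP => x0.
have c0 : 0 <= c by have := xe 1 ltr01; rewrite mulr1; apply: le_trans.
have [a a0 xa] : exists2 a : R, 0 < a & `|x| = a%:C%C.
  by apply: eps_real; rewrite lt_def x0 normr_ge0.
have := Re_ge0 c0; have := ge0_Re c0; move: (complex.Re c) => d cd d0.
have e0 : 0 < a / (d + 1) / 2 by rewrite !divr_gt0 // ltr_wpDl.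
have := xe (a / (d + 1) / 2)%:C%C; rewrite ltcR e0 xa cd -rmorphM lecR /=.
move=> /(_ isT); rewrite leNgt => /negP; apply.
rewrite !mulrA ltr_pdivrMr // ltr_pdivrMr ?ltr_wpDl //.
by nra.
Qed.

Lemma natSinv_lt a : 0 < a -> exists N, forall n, (N <= n)%N -> n.+1%:R^-1 < a.
Proof.
move=> a0; exists (Num.bound a^-1) => n Nn.
rewrite invf_plt ?posrE //; apply: lt_le_trans (archi_boundP _) _.
  by rewrite invr_ge0 ltW.
by rewrite ler_nat ltnW.
Qed.

(** Such a quadratic arises in Cauchy-Schwarz arguments when a vector is moved by s times the
    complex pairing: g is the squared modulus of that pairing, whence its two occurrences. The
    minimum is at s = 1/b. *)
Lemma discriminant_le a g b :
  0 <= g -> 0 <= b -> (forall s, 0 <= a - 2 * s * g + s ^+ 2 * g * b) ->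
  g <= a * b.
Proof.
move=> g0 b0 pos; case: (eqVneq b 0) => [b00|bn0].
  rewrite b00 mulr0 leNgt; apply/negP => gp.
  (* At this s the quadratic equals -1. *)
  have := pos ((a + 1) / (2 * g)); rewrite b00 mulr0 addr0.
  have -> : 2 * ((a + 1) / (2 * g)) * g = a + 1 by field; rewrite gt_eqF.
  by lra.
have bp : 0 < b by rewrite lt_def bn0.
have := pos b^-1.
have -> : a - 2 * b^-1 * g + b^-1 ^+ 2 * g * b = a - g / b by field.
by rewrite subr_ge0 ler_pdivrMr.
Qed.

End ComplexNumbers.

Section SemiInnerProduct.
Context {R : realType} {V : lmodType R[i]}.
Implicit Types (q : V -> V -> R[i]) (E : set V) (f : V -> R[i]).

Definition semi_ip q : Prop :=
  [/\ forall c u v w, q (c *: u + v) w = c * q u w + q v w,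
      forall u v, q v u = (q u v)^* & forall u, 0 <= q u u].

Definition subspace E : Prop :=
  E 0 /\ forall (c : R[i]) u v, E u -> E v -> E (c *: u + v).

Definition linear_on E f : Prop :=
  forall (c : R[i]) u v, E u -> E v -> f (c *: u + v) = c * f u + f v.

Lemma semi_ip_normD q u v s g : semi_ip q ->
  complex.Re (q (u + (s%:C%C * g) *: v) (u + (s%:C%C * g) *: v)) =
  complex.Re (q u u) + 2 * s * complex.Re (g * q v u)
    + s ^+ 2 * normc2 g * complex.Re (q v v).
Proof.
case=> ql qC q0.
have ql' c x y z : q (x + c *: y) z = q x z + c * q y z by rewrite addrC ql addrC.
rewrite ql' [q u _]qC [q v (_ + _)]qC !ql' (qC v u) !rmorphD !rmorphM /= -!qC.
rewrite (ge0_Re (q0 u)) (ge0_Re (q0 v)) (qC v u).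
move: (complex.Re (q u u)) (complex.Re (q v v)) (q v u) g.
by move=> a b [x y] [z t]; rewrite /normc2 /=; ring.
Qed.

Lemma semi_ip_CauchySchwarz q u v : semi_ip q ->
  normc2 (q u v) <= complex.Re (q u u) * complex.Re (q v v).
Proof.
move=> qs; have [_ qC q0] := qs; apply: discriminant_le.
- exact: normc2_ge0.
- exact/Re_ge0/q0.
move=> s; have := Re_ge0 (q0 (u + ((- s)%:C%C * q u v) *: v)).
rewrite semi_ip_normD // (qC u v) => h; apply: le_trans h _.
rewrite sqrrN le_eqVlt; apply/orP; left; apply/eqP.
by congr (_ + _ + _); case: (q u v) => x y; rewrite /normc2 /=; ring.
Qed.

(* [a] nearly minimises |u|^2 - 2 Re f(u) on E. *)
Lemma approx_riesz q E f k : semi_ip q -> subspace E -> linear_on E f ->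
  (forall u, E u -> normc2 (f u) <= k * complex.Re (q u u)) ->
  forall e : R, 0 < e -> exists2 a, E a &
    forall b, E b -> normc2 (f b - q b a) <= e * complex.Re (q b b).
Proof.
move=> qs [E0 ES] fl fb e e0; have [ql qC q0] := qs.
pose Phi u := complex.Re (q u u) - 2 * complex.Re (f u).
(* By AM-GM, 2 Re f(u) <= 2 sqrt(|k| N) <= |k| + N, where N is the real part of [q u u]. *)
have Phi_lb u : E u -> - `|k| <= Phi u.
  move=> Eu; have := fb u Eu; have := Re_ge0 (q0 u); rewrite /Phi /normc2.
  have := ler_norm k; have := normr_ge0 k.
  move: (`|k|) (complex.Re (q u u)) (complex.Re (f u)) (complex.Im (f u)).
  move=> k' N x y kp kk N0 h; case: (lerP x 0) => x0; first by lra.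
  have xx : x ^+ 2 <= k' * N.
    by have := ler_wpM2r N0 kk; have := sqr_ge0 y; lra.
  rewrite leNgt; apply/negP => lt.
  have : (k' + N) ^+ 2 < (2 * x) ^+ 2 by rewrite ltr_pXn2r // ?nnegrE; lra.
  by have := sqr_ge0 (k' - N); nra.
have hi : has_inf (Phi @` E).
  split; first by exists (Phi 0), 0.
  by exists (- `|k|) => _ [u Eu <-]; exact: Phi_lb.
have [_ [a Ea <-] ae] := inf_adherent e0 hi.
exists a => // b Eb.
apply: discriminant_le; [exact: normc2_ge0 | exact/Re_ge0/q0 |].
move=> s; set g := f b - q b a.
(* Moving a along b lowers Phi by less than e; in the variable s this is the quadratic of
   [discriminant_le] with constant term e. *)
have Et : E (a + (s%:C%C * g^*) *: b) by rewrite addrC; apply: ES.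
have : inf (Phi @` E) <= Phi (a + (s%:C%C * g^*) *: b).
  by apply: ge_inf; [case: hi | exists (a + (s%:C%C * g^*) *: b)].
have -> : Phi (a + (s%:C%C * g^*) *: b) =
    Phi a - 2 * s * normc2 g + s ^+ 2 * normc2 g * complex.Re (q b b).
  clear Et; rewrite /Phi semi_ip_normD // [a + _]addrC fl // ReD.
  have -> : q b a = f b - g by rewrite /g; ring.
  clearbody g; move: (f b) (f a) g => [x y] [x' y'] [x2 y2].
  by rewrite /normc2 /=; ring.
by move: ae; lra.
Qed.

End SemiInnerProduct.

(** * Hilbert spaces *)

Section HilbertSpaces.
Context {R : realType}.
Implicit Types H : hilbertType R.

Lemma ipC H (u v : H) : ip u v = (ip v u)^*.
Proof. by rewrite hermC expr0 mul1r. Qed.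

Lemma ipDl H (u v w : H) : ip (u + v) w = ip u w + ip v w.
Proof. exact: linearDl. Qed.

Lemma ipBl H (u v w : H) : ip (u - v) w = ip u w - ip v w.
Proof. exact: linearBl. Qed.

Lemma ipZl H c (u w : H) : ip (c *: u) w = c * ip u w.
Proof. exact: linearZl_LR. Qed.

Lemma ipDr H (u v w : H) : ip w (u + v) = ip w u + ip w v.
Proof. exact: linearDr. Qed.

Lemma ipZr H c (u w : H) : ip w (c *: u) = c^* * ip w u.
Proof. exact: linearZr_LR. Qed.

Lemma ip0l H (w : H) : ip 0 w = 0.
Proof. exact: linear0l. Qed.

Lemma ip0r H (w : H) : ip w 0 = 0.
Proof. exact: linear0r. Qed.

Lemma ip_suml H I (r : seq I) (P : pred I) (F : I -> H) w :
  ip (\sum_(i <- r | P i) F i) w = \sum_(i <- r | P i) ip (F i) w.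
Proof. exact: linear_sumlz. Qed.

Lemma ip_sumr H I (r : seq I) (P : pred I) (F : I -> H) w :
  ip w (\sum_(i <- r | P i) F i) = \sum_(i <- r | P i) ip w (F i).
Proof. exact: linear_sumr. Qed.

Lemma ip_eq0 H (u : H) : ip u u = 0 -> u = 0.
Proof.
by rewrite ip_norm => /eqP; rewrite sqrf_eq0 normr_eq0 => /eqP.
Qed.

Lemma ip_semi H : semi_ip (@ip R H).
Proof.
split=> [c u v w|u v|u]; last by rewrite ip_norm exprn_ge0.
  by rewrite ipDl ipZl.
exact: ipC.
Qed.

Lemma ip_le_norm H (u v : H) : `|ip u v| <= `|u| * `|v|.
Proof.
rewrite -(@ler_pXn2r _ 2) ?nnegrE ?mulr_ge0 // exprMn -!ip_norm -normc2E.
have [_ _ q0] := ip_semi H.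
rewrite (ge0_Re (q0 u)) (ge0_Re (q0 v)) -rmorphM lecR.
exact/semi_ip_CauchySchwarz/ip_semi.
Qed.

Lemma ip_ext H (u v : H) : (forall w, ip u w = ip v w) -> u = v.
Proof.
by move=> uv; apply/eqP; rewrite -subr_eq0; apply/eqP/ip_eq0; rewrite ipBl uv subrr.
Qed.

Lemma closure_normP H (S : set H) u :
  closure S u <-> forall e : R[i], 0 < e -> exists2 s, S s & `|u - s| < e.
Proof.
split=> [Su e e0|Su B /nbhs_ballP[e /= e0 Be]].
  have [s [Ss]] := Su _ (nbhsx_ballx u e e0).
  by rewrite -ball_normE; exists s.
have [s Ss us] := Su e e0; exists s; split=> //; apply: Be.
by rewrite -ball_normE.
Qed.

Lemma lipschitz_closure H H' (T : H -> H') C (S : set H) (S' : set H') :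
  0 <= C -> (forall u v, `|T u - T v| <= C * `|u - v|) ->
  (forall u, S u -> closure S' (T u)) -> forall u, closure S u -> closure S' (T u).
Proof.
move=> C0 TC TS u Su; apply: (@closed_closure _ S').
apply/closure_normP => e e0.
have d0 : 0 < e / (C + 1) by rewrite divr_gt0 // ltr_wpDl.
have [s Ss us] := (closure_normP _ _).1 Su _ d0.
exists (T s); first exact: TS.
apply: le_lt_trans (TC u s) _.
have [->|Cn0] := eqVneq C 0; first by rewrite mul0r.
have Cp : 0 < C by rewrite lt_def Cn0.
rewrite -ltr_pdivlMl // (lt_trans us) // ltr_pdivrMr ?ltr_wpDl //.
by rewrite mulrC mulrA mulrDl divff // mul1r mulrDl mul1r ltrDl mulr_gt0 ?invr_gt0.
Qed.

Lemma bounded_op_norm H (T : H -> H) : bounded_op T ->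
  exists2 C, 0 <= C & forall u, `|T u| <= C * `|u|.
Proof.
case=> Tl Tc.
pose T' : {linear H -> H} := HB.pack T (GRing.isLinear.Build _ _ _ _ T Tl).
have /linear_boundedP : bounded_near T' (nbhs (0 : H)).
  exact/linear_bounded_continuous.
by move=> /pinfty_ex_gt0 [C /ltW C0 TC]; exists C.
Qed.

Lemma cauchy_limit H (s : nat -> H) :
  (forall e : R[i], 0 < e -> exists N, forall m n,
     (N <= m)%N -> (N <= n)%N -> `|s m - s n| < e) ->
  exists l, forall e : R[i], 0 < e -> exists N, forall n,
     (N <= n)%N -> `|l - s n| < e.
Proof.
move=> sC; have /cvg_ex[l sl] : cvg (s @ \oo).
  apply/cauchy_cvgP/cauchy_ballP => e e0; have [N NP] := sC _ e0.
  have near_s : \forall x \near s @ \oo, exists2 n, (N <= n)%N & x = s n.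
    by exists N => // n Nn; exists n.
  near=> x y; rewrite -ball_normE /=.
  have [m Nm ->] : exists2 n, (N <= n)%N & x = s n by near: x.
  have [n Nn ->] : exists2 n, (N <= n)%N & y = s n by near: y.
  exact: NP.
exists l => e e0; have [N _ NP] := (cvgrPdist_lt _ _).1 sl _ e0.
by exists N.
Unshelve. all: by end_near. Qed.

End HilbertSpaces.

(** * Finite powers of a Hilbert space and Riesz representation *)

Section HilbertPowers.
Context {R : realType} {K : hilbertType R} {Z : finType}.
Implicit Types (u v w : Z -> K) (E : set (Z -> K)).

Lemma pow_ipC u v : pow_ip u v = (pow_ip v u)^*.
Proof. by rewrite rmorph_sum; apply: eq_bigr => z _; exact: ipC. Qed.

Lemma pow_ipDl u v w : pow_ip (u + v) w = pow_ip u w + pow_ip v w.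
Proof. by rewrite -big_split; apply: eq_bigr => z _; rewrite ipDl. Qed.

Lemma pow_ipZl c u w : pow_ip (c *: u) w = c * pow_ip u w.
Proof. by rewrite mulr_sumr; apply: eq_bigr => z _; rewrite ipZl. Qed.

Lemma pow_ipNl u w : pow_ip (- u) w = - pow_ip u w.
Proof. by rewrite -scaleN1r pow_ipZl mulN1r. Qed.

Lemma pow_ipBl u v w : pow_ip (u - v) w = pow_ip u w - pow_ip v w.
Proof. by rewrite pow_ipDl pow_ipNl. Qed.

Lemma pow_ipBr u v w : pow_ip w (u - v) = pow_ip w u - pow_ip w v.
Proof. by rewrite pow_ipC pow_ipBl rmorphB; congr (_ - _); exact/esym/pow_ipC. Qed.

Lemma pow_ip0r w : pow_ip w 0 = 0.
Proof. by rewrite -[0](subrr w) pow_ipBr subrr. Qed.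

Lemma pow_ipNr u w : pow_ip w (- u) = - pow_ip w u.
Proof. by rewrite -[- u]sub0r pow_ipBr pow_ip0r sub0r. Qed.

Lemma pow_ipDr u v w : pow_ip w (u + v) = pow_ip w u + pow_ip w v.
Proof. by rewrite -{1}[v]opprK pow_ipBr pow_ipNr opprK. Qed.

Lemma pow_ip0l w : pow_ip 0 w = 0.
Proof. by rewrite -[0](subrr w) pow_ipBl subrr. Qed.

Lemma pow_ip_norm u : pow_ip u u = \sum_(z : Z) `|u z| ^+ 2.
Proof. by apply: eq_bigr => z _; rewrite ip_norm. Qed.

Lemma pow_ip_semi : semi_ip (@pow_ip R K Z).
Proof.
split=> [c u v w|u v|u]; first by rewrite pow_ipDl pow_ipZl.
  exact: pow_ipC.
by rewrite pow_ip_norm sumr_ge0 // => z _; rewrite exprn_ge0.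
Qed.

Lemma pow_ip_ge0 u : 0 <= pow_ip u u.
Proof. by have [_ _] := pow_ip_semi; apply. Qed.

Lemma pow_ip_eq0 u : pow_ip u u = 0 -> u = 0.
Proof.
move=> u0; apply/funext => z; apply/eqP; rewrite -normr_eq0 -sqrf_eq0.
rewrite (psumr_eq0P (P := predT) (F := fun z => `|u z| ^+ 2)) //.
  by move=> i _; rewrite exprn_ge0.
by rewrite -pow_ip_norm.
Qed.

Lemma norm_coord_le u z : `|u z| ^+ 2 <= pow_ip u u.
Proof.
rewrite pow_ip_norm (bigD1 z) //= lerDl sumr_ge0 // => i _.
by rewrite exprn_ge0.
Qed.

Lemma norm_coord_le_pow u z : `|u z| <= pow_norm u.
Proof.
rewrite -[leLHS]sqrCK // ler_sqrtC ?qualifE /= ?exprn_ge0 ?sumr_ge0 //.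
  by rewrite -pow_ip_norm norm_coord_le.
by move=> *; rewrite exprn_ge0.
Qed.

Lemma pow_ip_le u v : `|pow_ip u v| <= \sum_(z : Z) `|u z| * `|v z|.
Proof.
by apply: le_trans (ler_norm_sum _ _ _) (ler_sum _ _) => z _; exact: ip_le_norm.
Qed.

(** As Z is finite, this is the closure for [pow_norm], phrased without square roots. *)
Definition pow_closure E : set (Z -> K) :=
  [set w | forall e : R[i], 0 < e ->
     exists2 w', E w' & forall z, `|w z - w' z| < e].

Lemma sub_pow_closure E : E `<=` pow_closure E.
Proof. by move=> w Ew e e0; exists w => // z; rewrite subrr normr0. Qed.

Lemma pow_closure_subspace E : subspace E -> subspace (pow_closure E).
Proof.
case=> E0 ES; split; first exact: sub_pow_closure.
move=> c u v Eu Ev e e0.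
have d0 : 0 < e / (`|c| + 1) by rewrite divr_gt0 // ltr_wpDl.
have [u' Eu' uu'] := Eu _ (divr_gt0 d0 (ltr0Sn _ 1)).
have [v' Ev' vv'] := Ev _ (divr_gt0 e0 (ltr0Sn _ 1)).
exists (c *: u' + v'); first exact: ES.
move=> z; rewrite /= !fctE opprD addrACA -scalerBr.
apply: le_lt_trans (ler_normD _ _) _; rewrite [e in ltRHS](splitr e).
apply: ler_ltD (vv' z); rewrite normrZ.
apply: le_trans (ler_wpM2l _ (ltW (uu' z))) _ => //.
rewrite mulrA ler_pM2r ?invr_gt0 // mulrA ler_pdivrMr ?ltr_wpDl //.
by rewrite mulrDr mulr1 mulrC lerDl ltW.
Qed.

Lemma pow_closure_eq0 E (F : (Z -> K) -> R[i]) C :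
  (forall u v, F (u - v) = F u - F v) ->
  0 <= C -> (forall u, `|F u| <= C * \sum_(z : Z) `|u z|) ->
  (forall u, E u -> F u = 0) -> forall u, pow_closure E u -> F u = 0.
Proof.
move=> FB C0 FC F0 u Eu; apply: (@eq0_le_eps _ _ (C * #|Z|%:R)) => e e0.
have [v Ev uv] := Eu _ e0.
rewrite -[F u]subr0 -(F0 v Ev) -FB -mulrA; apply: le_trans (FC _) _.
rewrite ler_wpM2l // -sum1_card natr_sum mulr_suml ler_sum // => z _.
by rewrite mul1r ltW // uv.
Qed.

Definition pow_sqnorm u : R := complex.Re (pow_ip u u).

Lemma pow_sqnormE u : pow_ip u u = (pow_sqnorm u)%:C%C.
Proof. exact/ge0_Re/pow_ip_ge0. Qed.

Lemma pow_sqnorm_ge0 u : 0 <= pow_sqnorm u.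
Proof. exact/Re_ge0/pow_ip_ge0. Qed.

Lemma pow_sqnorm_eq0 u : pow_sqnorm u = 0 -> u = 0.
Proof. by move=> u0; apply: pow_ip_eq0; rewrite pow_sqnormE u0. Qed.

Lemma pow_sqnormN u : pow_sqnorm (- u) = pow_sqnorm u.
Proof. by apply: complexI; rewrite -!pow_sqnormE pow_ipNl pow_ipNr opprK. Qed.

Lemma pow_sqnormB_le u v :
  pow_sqnorm (u - v) <= 2 * pow_sqnorm u + 2 * pow_sqnorm v.
Proof.
rewrite -subr_ge0 [leRHS](_ : _ = pow_sqnorm (u + v)) ?pow_sqnorm_ge0 //.
apply: complexI; rewrite rmorphB rmorphD !rmorphM /= -!pow_sqnormE.
rewrite pow_ipBl !pow_ipBr pow_ipDl !pow_ipDr.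
rewrite -[2%:C%C]/(2%:R%:C%C) rmorph_nat; ring.
Qed.

Lemma pow_ip_CauchySchwarz u v :
  normc2 (pow_ip u v) <= pow_sqnorm u * pow_sqnorm v.
Proof. exact/semi_ip_CauchySchwarz/pow_ip_semi. Qed.

Lemma pow_sqnorm_coord u z (e : R) :
  0 < e -> pow_sqnorm u < e ^+ 2 -> `|u z| < e%:C%C.
Proof.
move=> e0 ue; rewrite -(@ltr_pXn2r _ 2) ?nnegrE ?normr_ge0 ?ler0c ?ltW //.
apply: le_lt_trans (norm_coord_le _ z) _.
by rewrite pow_sqnormE -rmorphXn /= ltcR.
Qed.

Lemma pow_sqnorm_le u (e : R) :
  (forall z, `|u z| <= e%:C%C) -> pow_sqnorm u <= #|Z|%:R * e ^+ 2.
Proof.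
move=> ue; rewrite /pow_sqnorm pow_ip_norm Re_sum -sum1_card natr_sum mulr_suml.
apply: ler_sum => z _; rewrite mul1r -[e ^+ 2]/(complex.Re (e ^+ 2)%:C%C).
apply: Re_le; rewrite rmorphXn /= lerXn2r ?nnegrE //.
exact: le_trans (ue z).
Qed.

Lemma pow_cauchy_limit (s : nat -> Z -> K) :
  (forall e : R, 0 < e -> exists N, forall m n, (N <= m)%N -> (N <= n)%N ->
     pow_sqnorm (s m - s n) < e) ->
  exists l, forall e : R, 0 < e -> exists N, forall n, (N <= n)%N ->
     pow_sqnorm (l - s n) < e.
Proof.
move=> sC.
have lim z : exists l, forall e : R[i], 0 < e -> exists N, forall n,
     (N <= n)%N -> `|l - s n z| < e.
  apply: (cauchy_limit (s := fun n => s n z)) => _ /eps_real[e e0 ->].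
  have [N NP] := sC (e ^+ 2) (exprn_gt0 _ e0); exists N => m n Nm Nn.
  exact: (pow_sqnorm_coord z e0 (NP m n Nm Nn)).
have [l lP] := boolp.choice lim.
(* Coordinates within d give a squared norm of at most |Z| d^2, which is below e; the + 1 keeps this
   strict and covers an empty Z. *)
exists l => e e0; pose d := Num.sqrt (e / (#|Z|%:R + 1)).
have dd : 0 < e / (#|Z|%:R + 1) by rewrite divr_gt0 // ltr_wpDl.
have d0 : 0 < d by rewrite sqrtr_gt0.
have dC : 0 < d%:C%C by rewrite ltcR.
have /boolp.choice[N NP] := fun z => lP z _ dC.
exists (\sum_z N z)%N => n Nn.
have le_d z : `|(l - s n) z| <= d%:C%C.
  apply/ltW/NP/(leq_trans _ Nn).
  by rewrite (bigD1 z) //= leq_addr.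
apply: le_lt_trans (pow_sqnorm_le le_d) _.
rewrite sqr_sqrtr ?ltW // mulrA ltr_pdivrMr ?ltr_wpDl //.
by rewrite mulrDr mulr1 mulrC ltrDl.
Qed.

(** V is not complete and v need not be injective: f is represented only after transport along v, by
    a limit of images of near minimisers. With v the identity this gives orthogonal projections;
    through [riesz], with v = [vec] it gives values of adjoints, and with v = [lin_ext] it extends
    maps from formal tensors to K. *)
Lemma riesz_pow (V : lmodType R[i]) (v : V -> Z -> K) (E : set V)
    (f : V -> R[i]) k :
  (forall c x y, v (c *: x + y) = c *: v x + v y) ->
  subspace E -> linear_on E f ->
  (forall x, E x -> normc2 (f x) <= k * pow_sqnorm (v x)) ->
  exists2 xi, pow_closure (v @` E) xi & forall b, E b -> f b = pow_ip (v b) xi.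
Proof.
move=> vl ES fl fb; pose q x y := pow_ip (v x) (v y).
have qs : semi_ip q.
  have [ql qC q0] := pow_ip_semi.
  by split=> *; rewrite /q ?vl //.
have e_gt0 n : (0 : R) < n.+1%:R^-1 by rewrite invr_gt0.
have /boolp.choice[a_ aP] : forall n, exists x, E x /\
    forall b, E b -> normc2 (f b - q b x) <= n.+1%:R^-1 * pow_sqnorm (v b).
  by move=> n; have [x] := approx_riesz qs ES fl fb (e_gt0 n); exists x.
have vB x y : v (x - y) = v x - v y by rewrite addrC -scaleN1r vl scaleN1r addrC.
(* For b = a_m - a_n, [q b b] is the difference of the errors made by a_m and a_n in representing f
   at b itself. Both squared errors are small multiples of [q b b], which bounds it. *)
have a_cauchy m n : pow_sqnorm (v (a_ m) - v (a_ n)) <=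
    2 * (m.+1%:R^-1 + n.+1%:R^-1).
  rewrite -vB; set b := a_ m - a_ n; have [[Em Pm] [En Pn]] := (aP m, aP n).
  have Eb : E b by rewrite /b addrC -scaleN1r; apply: ES.2.
  have := normc2D (- (f b - q b (a_ m))) (f b - q b (a_ n)).
  have -> : - (f b - q b (a_ m)) + (f b - q b (a_ n)) = q b b.
    have -> : q b b = q b (a_ m) - q b (a_ n) by rewrite /q -pow_ipBr -vB.
    by ring.
  rewrite normc2N [q b b]pow_sqnormE normc2R.
  have := e_gt0 m; have := e_gt0 n.
  have := Pm b Eb; have := Pn b Eb; have := pow_sqnorm_ge0 (v b).
  move: (pow_sqnorm (v b)) (m.+1%:R^-1) (n.+1%:R^-1) => N c d.
  move: (normc2 _) (normc2 _) => x y N0 h1 h2 c0 d0 h3.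
  have : N * N <= 2 * (c + d) * N by lra.
  have [-> _|Nn0] := eqVneq N 0; last by rewrite ler_pM2r // lt_def Nn0.
  by rewrite mulr_ge0 // addr_ge0 // ltW.
have [e e0|xi xiP] := @pow_cauchy_limit (v \o a_).
  have /natSinv_lt[N NP] : 0 < e / 4 by rewrite divr_gt0.
  exists N => m n /NP Nm /NP Nn; apply: le_lt_trans (a_cauchy m n) _.
  by move: (m.+1%:R^-1) (n.+1%:R^-1) Nm Nn => c d; lra.
exists xi => [_ /eps_real[e e0 ->]|b Eb].
  have [N NP] := xiP (e ^+ 2) (exprn_gt0 _ e0).
  exists (v (a_ N)); first by exists (a_ N); first exact: (aP N).1.
  by move=> z; exact: (pow_sqnorm_coord z e0 (NP N (leqnn N))).
apply/eqP; rewrite -subr_eq0; apply/eqP/normc2_eq0/le_anti.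
rewrite normc2_ge0 andbT; apply/ler_addgt0Pr => e e0; rewrite add0r.
have b0 := pow_sqnorm_ge0 (v b).
have b1 : 0 < pow_sqnorm (v b) + 1 by rewrite ltr_wpDl.
have d0 : 0 < e / 4 / (pow_sqnorm (v b) + 1) by rewrite !divr_gt0.
have [[N NP] [N' NP']] := (natSinv_lt d0, xiP _ d0).
have [n [Nn N'n]] : exists n, (N <= n)%N /\ (N' <= n)%N.
  by exists (N + N')%N; rewrite leq_addr leq_addl.
have -> : f b - pow_ip (v b) xi = (f b - q b (a_ n)) - pow_ip (v b) (xi - v (a_ n)).
  by rewrite pow_ipBr /q; ring.
apply: le_trans (normc2D _ _) _; rewrite normc2N.
have := (aP n).2 b Eb; have := pow_ip_CauchySchwarz (v b) (xi - v (a_ n)).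
move: (NP n Nn) (NP' n N'n) (pow_sqnorm_ge0 (xi - v (a_ n))) b0 => /=.
have := e_gt0 n; rewrite !(ltr_pdivlMr _ _ b1).
move: (n.+1%:R^-1) (pow_sqnorm (v b)) (pow_sqnorm (xi - _)) (normc2 _) (normc2 _).
by move=> c N1 d x y; nra.
Qed.

End HilbertPowers.

Lemma riesz (R : realType) (H : hilbertType R) (V : lmodType R[i]) (v : V -> H)
    (E : set V) (f : V -> R[i]) k :
  (forall c x y, v (c *: x + y) = c *: v x + v y) ->
  subspace E -> linear_on E f ->
  0 <= k -> (forall x, E x -> `|f x| <= k * `|v x|) ->
  exists2 xi, closure (v @` E) xi & forall b, E b -> f b = ip (v b) xi.
Proof.
move=> vl ES fl k0 fb; pose v' x (_ : unit) := v x.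
have pow1 (u w : unit -> H) : pow_ip u w = ip (u tt) (w tt).
  by rewrite /pow_ip (bigD1 tt) //= big1 ?addr0 // => -[].
have [xi xiE xif] : exists2 xi, pow_closure (v' @` E) xi &
    forall b, E b -> f b = pow_ip (v' b) xi.
  apply: (riesz_pow (k := complex.Re k ^+ 2)) => // [c x y|x Ex].
    by apply/funext => z; exact: vl.
  rewrite -lecR normc2E rmorphM rmorphXn /= -ge0_Re // -pow_sqnormE pow1 ip_norm.
  by rewrite -exprMn lerXn2r ?nnegrE ?mulr_ge0 // fb.
exists (xi tt) => [|b Eb]; last by rewrite xif // pow1.
apply/closure_normP => e e0; have [w [x Ex <-] wx] := xiE e e0.
by exists (v x); [exists x|exact: wx].
Qed.

(** * Projectors *)

Section Projections.
Context {R : realType} {K : hilbertType R} {Z : finType}.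
Implicit Types (u v w : Z -> K) (E : set (Z -> K)) (T P Q : (Z -> K) -> (Z -> K)).

(** Operators are bare functions: having an adjoint already makes them additive ([adjointB]), so
    linearity is never carried along. *)
Definition adjoint T T' : Prop := forall u v, pow_ip (T u) v = pow_ip u (T' v).

Lemma adjoint_sym T T' : adjoint T T' -> adjoint T' T.
Proof. by move=> TT' u v; rewrite pow_ipC -TT' -pow_ipC. Qed.

Lemma adjointB T T' u v : adjoint T T' -> T (u - v) = T u - T v.
Proof.
move=> TT'; apply/eqP; rewrite -subr_eq0; apply/eqP/pow_ip_eq0.
by rewrite !pow_ipBl !TT' -!pow_ipBl subrr pow_ip0l.
Qed.

Lemma adjoint_comp T T' S S' :
  adjoint T T' -> adjoint S S' -> adjoint (T \o S) (S' \o T').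
Proof. by move=> TT' SS' u v; rewrite /= TT' SS'. Qed.

Lemma adjoint_iter T T' n : adjoint T T' -> adjoint (iter n T) (iter n T').
Proof.
by move=> TT'; elim: n => [//|n IHn] u v; rewrite iterS TT' IHn -iterSr.
Qed.

Definition orth_projector P : Prop := adjoint P P /\ forall u, P (P u) = P u.

Lemma orth_projector_sqnorm P u : orth_projector P ->
  pow_ip (P u) u = (pow_sqnorm (P u))%:C%C.
Proof. by case=> Pa PP; rewrite -pow_sqnormE [RHS]Pa PP Pa. Qed.

Lemma orth_projector_compl P :
  orth_projector P -> orth_projector (fun u => u - P u).
Proof.
case=> Pa PP; split=> [u v|u]; last first.
  by rewrite (adjointB _ _ Pa) PP subrr subr0.
by rewrite pow_ipBl pow_ipBr Pa.
Qed.

Lemma orth_projector_pythagoras P u : orth_projector P ->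
  pow_sqnorm u = pow_sqnorm (P u) + pow_sqnorm (u - P u).
Proof.
move=> Pp; have := orth_projector_sqnorm u (orth_projector_compl Pp).
rewrite pow_ipBl orth_projector_sqnorm // pow_sqnormE => h.
by apply: complexI; rewrite rmorphD /= -h addrC subrK.
Qed.

Lemma orth_projector_le P u : orth_projector P -> pow_sqnorm (P u) <= pow_sqnorm u.
Proof.
by move=> Pp; rewrite [leRHS](orth_projector_pythagoras u Pp) lerDl pow_sqnorm_ge0.
Qed.

Section AlternatingProjections.
Variables (P Q : (Z -> K) -> (Z -> K)).
Hypotheses (Pp : orth_projector P) (Qp : orth_projector Q).
Hypothesis PQ0 : forall u, P u = u -> Q u = u -> u = 0.

Let A := P \o Q \o P.

Lemma PQP_adjoint : adjoint A A.
Proof.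
have [[Pa _] [Qa _]] := (Pp, Qp).
by move=> u v; rewrite /A /= Pa Qa Pa.
Qed.

Lemma PQP_le u : pow_sqnorm (A u) <= pow_sqnorm u.
Proof.
apply: le_trans (orth_projector_le _ Pp) _.
exact: le_trans (orth_projector_le _ Qp) (orth_projector_le _ Pp).
Qed.

(** By Pythagoras, a projector that does not shrink a vector fixes it; equality leaves no room for
    any of the three factors to shrink. *)
Lemma PQP_fixed u : pow_sqnorm (A u) = pow_sqnorm u -> u = 0.
Proof.
move=> Au; have le1 := orth_projector_le (Q (P u)) Pp.
have le2 := orth_projector_le (P u) Qp; have le3 := orth_projector_le u Pp.
have fixed T v : orth_projector T -> pow_sqnorm v <= pow_sqnorm (T v) -> T v = v.
  move=> Tp le; apply/esym/eqP; rewrite -subr_eq0; apply/eqP/pow_sqnorm_eq0.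
  have := orth_projector_pythagoras v Tp; have := pow_sqnorm_ge0 (v - T v).
  by move: le; lra.
have Pu : P u = u.
  by apply: fixed => //; rewrite -Au; exact: le_trans le1 le2.
apply: PQ0 => //; apply: fixed => //; rewrite -Au -[in leRHS]Pu; exact: le1.
Qed.

(** Alternating projections converge to the projection on the common range, here 0. The squared
    norms c n decrease to a limit, which forces the even iterates to be Cauchy; their limit is fixed
    by A^2, hence has its norm preserved by A. *)
Lemma PQP_iter_cvg0 u (e : R) : 0 < e ->
  exists N, forall n, (N <= n)%N -> pow_sqnorm (iter n A u) < e.
Proof.
move=> e0; pose x n := iter n A u; pose c n := pow_sqnorm (x n).
have xD i j : pow_ip (x i) (x j) = pow_ip (x (i + j)%N) u.
  by rewrite /x -(adjoint_iter j PQP_adjoint) -iterD addnC.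
have c_ler m n : (m <= n)%N -> c n <= c m.
  by move=> /subnK <-; elim: (n - m)%N => // k; exact: le_trans (PQP_le _).
have [l c_cvg] : exists l, forall d : R, 0 < d -> exists N, forall n, (N <= n)%N ->
    l <= c n < l + d.
  have hi : has_inf (range c).
    by split; [exists (c 0%N), 0%N|exists 0 => _ [n _ <-]; exact: pow_sqnorm_ge0].
  exists (inf (range c)) => d d0; have [_ [N _ <-] cN] := inf_adherent d0 hi.
  exists N => n /c_ler cn; rewrite (le_lt_trans cn cN) andbT.
  by apply: ge_inf; [case: hi|exists n].
(* With even indices <x_2m, x_2n> = c (m + n), so the squared distance is c(2m) - 2 c(m + n) +
   c(2n), where all three values are close to l. *)
have [d d0|z zP] := @pow_cauchy_limit R K Z (fun n => x (n + n)%N).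
  have [N NP] := c_cvg (d / 2) (divr_gt0 d0 (ltr0Sn _ 1)).
  exists N => m n Nm Nn.
  have -> : pow_sqnorm (x (m + m)%N - x (n + n)%N) =
      c (m + m)%N - 2 * c (m + n)%N + c (n + n)%N.
    apply: complexI; rewrite rmorphD rmorphB rmorphM /= /c -!pow_sqnormE.
    rewrite pow_ipBl !pow_ipBr !xD [(n + n + _)%N]addnC [(m + m + (n + n))%N]addnACA.
    by rewrite -[2%:C%C]/(2%:R%:C%C) rmorph_nat; ring.
  have := NP (m + m)%N; have := NP (m + n)%N; have := NP (n + n)%N.
  rewrite !(leq_trans _ (leq_addr _ _)) // => /(_ isT)/andP[a1 a2] /(_ isT)/andP[a3 a4].
  by move=> /(_ isT)/andP[a5 a6]; lra.
(* Passing from one even index to the next applies A twice, so the limit is first seen to be fixed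
   by A^2 only. *)
have AAz : A (A z) = z.
  apply/eqP; rewrite -subr_eq0 -oppr_eq0 opprB; apply/eqP/pow_sqnorm_eq0/le_anti.
  rewrite pow_sqnorm_ge0 andbT; apply/ler_addgt0Pr => d d0; rewrite add0r.
  have [N NP] := zP _ (divr_gt0 d0 (ltr0Sn _ 3)).
  have -> : z - A (A z) = (z - x (N.+1 + N.+1)%N) - A (A (z - x (N + N)%N)).
    rewrite !(adjointB _ _ PQP_adjoint) addSn addnS {1}/x !iterS.
    by rewrite opprB addrA subrK.
  apply: le_trans (pow_sqnormB_le _ _) _.
  have := NP _ (leqnSn N); have := NP _ (leqnn N).
  have := le_trans (PQP_le (A (z - x (N + N)%N))) (PQP_le (z - x (N + N)%N)).
  by lra.
have z0 : z = 0.
  apply: PQP_fixed; apply/le_anti; rewrite PQP_le /= -{1}AAz.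
  exact: PQP_le.
have [N NP] := zP e e0; exists (N + N)%N => n /c_ler cn.
by apply: le_lt_trans cn _; have := NP N (leqnn N); rewrite z0 sub0r pow_sqnormN.
Qed.

(** An even power turns the diagonal pairing into a squared norm, so that it is nonnegative and also
    controlled by [PQP_iter_cvg0]. *)
Lemma PQP_iter_ip u n :
  pow_ip (iter (n + n) A (P u)) u = (pow_sqnorm (iter n A (P u)))%:C%C.
Proof.
have [Pa PP] := Pp.
have PA m v : P v = v -> P (iter m A v) = iter m A v.
  by move=> Pv; case: m => // m; rewrite iterS /A /= PP.
rewrite -pow_sqnormE -(PA (n + n)%N) ?PP // Pa iterD.
by rewrite (adjoint_iter n PQP_adjoint).
Qed.

End AlternatingProjections.

End Projections.

(** * Trace and dimension *)

Section ProjectorOnClosure.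
Context {R : realType} {K : hilbertType R} {Z : finType}.
Variable E : set (Z -> K).
Hypothesis E_sub : subspace E.

Lemma pow_closure_orth (u w : Z -> K) : (forall b, E b -> pow_ip b u = 0) ->
  pow_closure E w -> pow_ip w u = 0.
Proof.
move=> Eu; apply: (@pow_closure_eq0 _ _ _ _ (fun b => pow_ip b u) (\sum_z `|u z|)) => //.
- by move=> v v'; exact: pow_ipBl.
- by rewrite sumr_ge0.
move=> b; apply: le_trans (pow_ip_le _ _) _; rewrite mulr_sumr ler_sum // => z _.
by rewrite mulrC ler_wpM2r // (bigD1 z) //= lerDl sumr_ge0.
Qed.

Lemma orth_projector_exists : exists P, [/\ orth_projector P,
  forall u, pow_closure E (P u) &
  forall b u, pow_closure E b -> pow_ip b (P u) = pow_ip b u].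
Proof.
have /boolp.choice[P PP] : forall u : Z -> K, exists p, pow_closure E p /\
    forall b, pow_closure E b -> pow_ip b p = pow_ip b u.
  move=> u; have [||b Eb|p Ep bp] := @riesz_pow R K Z (Z -> K) id E
      (pow_ip^~ u) (pow_sqnorm u) _ E_sub => //.
  - by move=> c x y _ _; rewrite pow_ipDl pow_ipZl.
  - by rewrite mulrC; exact: pow_ip_CauchySchwarz.
  exists p; split; first by rewrite image_id in Ep.
  move=> b /(pow_closure_orth (u := p - u)); rewrite pow_ipBr => /(_ _)/eqP.
  rewrite subr_eq0 => /(_ _)/eqP; apply=> c Ec.
  by rewrite pow_ipBr -bp // subrr.
exists P; split=> [|u|b u Eb]; [|exact: (PP u).1|exact: (PP u).2].
have PA : adjoint P P.
  move=> u v; rewrite -((PP v).2 _ (PP u).1) pow_ipC ((PP u).2 _ (PP v).1).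
  by rewrite -pow_ipC.
split=> // u; apply/eqP; rewrite -subr_eq0; apply/eqP/pow_ip_eq0.
rewrite pow_ipBr (PP (P u)).2 ?subrr // addrC -scaleN1r.
by apply: (pow_closure_subspace E_sub).2; exact: (PP _).1.
Qed.

End ProjectorOnClosure.

(** * The trace on operators commuting with a right action *)

Section TracialFrame.
Context {R : realType} {K : hilbertType R} {Z : finType}.
(** Intended reading: i stands for an elementary tensor x of B (x) B^o, [rho i] for right
    multiplication by x, [st] for the adjoint, [J] for y |-> y^*, [one] for 1 (x) 1 and [K0] for
    L^2(B (x) B^o). The set K0 is kept apart from K because the vectors [rho i one] are total in K0
    only ([K0_sep]). *)
Variables (I : Type) (rho : I -> K -> K) (st : I -> I) (J : K -> K) (one : K).
Variable K0 : set K.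
Hypothesis rho_adj : forall i u v, ip (rho i u) v = ip u (rho (st i) v).
Hypothesis rho_stK : forall i u, rho (st (st i)) u = rho i u.
Hypothesis J_ip : forall u v, ip (J u) (J v) = ip v u.
Hypothesis J_rho : forall i, J (rho (st i) one) = rho i one.
Hypothesis K0_subspace : subspace K0.
Hypothesis K0_one : K0 one.
Hypothesis K0_J : forall u, K0 u -> K0 (J u).
Hypothesis K0_sep : forall u, K0 u -> (forall i, ip u (rho i one) = 0) -> u = 0.

Implicit Types (T S : (Z -> K) -> (Z -> K)) (u v : Z -> K).

Definition coordwise (f : K -> K) u : Z -> K := fun z => f (u z).

Definition one_at z : Z -> K := fun z' => if z' == z then one else 0.

Definition optrace T : R[i] := \sum_z pow_ip (T (one_at z)) (one_at z).

(* When u |-> rho i u is a right action, these are the operators of the matrix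
   algebra over the left von Neumann algebra, on which [optrace] is the trace. *)
Definition commutes_rho T : Prop :=
  (forall i u, T (coordwise (rho i) u) = coordwise (rho i) (T u)) /\
  forall u, (forall z, K0 (u z)) -> forall z, K0 (T u z).

Definition commutes_rho_pair T T' : Prop :=
  [/\ adjoint T T', commutes_rho T & commutes_rho T'].

Lemma commutes_rho_pair_sym T T' :
  commutes_rho_pair T T' -> commutes_rho_pair T' T.
Proof. by case=> TT' cT cT'; split=> //; exact: adjoint_sym. Qed.

Lemma commutes_rho_pair_comp T T' S S' : commutes_rho_pair T T' ->
  commutes_rho_pair S S' -> commutes_rho_pair (T \o S) (S' \o T').
Proof.
case=> TT' [cT hT] [cT' hT'] [SS' [cS hS] [cS' hS']].
split; first exact: adjoint_comp.
- by split=> [i u|u Hu] /=; [rewrite cS cT|exact/hT/hS].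
- by split=> [i u|u Hu] /=; [rewrite cT' cS'|exact/hS'/hT'].
Qed.

Lemma commutes_rho_pair_iter T T' n : commutes_rho_pair T T' ->
  commutes_rho_pair (iter n T) (iter n T').
Proof.
case=> TT' [cT hT] [cT' hT']; split; first exact: adjoint_iter.
- by split; elim: n => // n IHn *; rewrite !iterS ?IHn ?cT //; exact/hT/IHn.
- by split; elim: n => // n IHn *; rewrite !iterS ?IHn ?cT' //; exact/hT'/IHn.
Qed.

Lemma ip_one_at u z (v : K) :
  ip v (u z) = pow_ip (fun z' => if z' == z then v else 0) u.
Proof.
rewrite /pow_ip (bigD1 z) //= eqxx big1 ?addr0 // => i /negPf ->.
exact: ip0l.
Qed.

Lemma rho0 i : rho i 0 = 0.
Proof. by apply: ip_eq0; rewrite rho_adj ip0l. Qed.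

Lemma coordwise_one_at i z :
  coordwise (rho i) (one_at z) = fun z' => if z' == z then rho i one else 0.
Proof.
apply/funext => z'; rewrite /coordwise /one_at.
by case: ifP => //; rewrite rho0.
Qed.

Lemma K0_one_at z z' : K0 (one_at z z').
Proof. by rewrite /one_at; case: ifP => // _; exact: K0_subspace.1. Qed.

(** The vector T(e_z)_w is the entry of index (w, z) of the matrix of T, applied to 1 (x) 1. The
    lemma is thus the usual formula for the entries of an adjoint matrix, checked against the total
    vectors [rho i one]. *)
Lemma J_coef T T' z w : commutes_rho_pair T T' ->
  J (T (one_at z) w) = T' (one_at w) z.
Proof.
case=> TT' [cT hT] [cT' hT']; apply/eqP; rewrite -subr_eq0; apply/eqP.
have K0B (u v : K) : K0 u -> K0 v -> K0 (v - u).
  by move=> Hu Hv; rewrite addrC -scaleN1r; apply: K0_subspace.2.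
apply: K0_sep => [|i].
  by apply: K0B; [apply: hT'|apply/K0_J/hT] => z'; exact: K0_one_at.
rewrite ipBl -{1}J_rho J_ip.
rewrite ip_one_at -coordwise_one_at.
have rho_pow u v : pow_ip (coordwise (rho (st i)) u) v = pow_ip u (coordwise (rho i) v).
  by apply: eq_bigr => y _; rewrite rho_adj rho_stK.
rewrite rho_pow -cT -(adjoint_sym TT') coordwise_one_at.
by rewrite pow_ipC -ip_one_at -ipC subrr.
Qed.

(** Each side is a double sum of pairings of matrix entries. The antiunitary J swaps the arguments
    of each pairing and, by [J_coef], replaces the entries by the transposed ones of the
    adjoints. *)
Lemma optrace_comm T T' S S' :
  commutes_rho_pair T T' -> commutes_rho_pair S S' ->
  optrace (T \o S) = optrace (S \o T).
Proof.
move=> cT cS; have [[aT _ _] [aS _ _]] := (cT, cS).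
have trE A A' B : adjoint A A' -> optrace (A \o B) =
    \sum_z \sum_w ip (B (one_at z) w) (A' (one_at z) w).
  by move=> AA'; apply: eq_bigr => z _; rewrite /= AA'.
rewrite (trE _ _ _ aT) (trE _ _ _ aS) exchange_big /=.
apply: eq_bigr => z _; apply: eq_bigr => w _.
rewrite -J_ip (J_coef _ _ cS) (J_coef _ _ (commutes_rho_pair_sym cT)) //.
Qed.

Hypothesis K0_closed : closure K0 `<=` K0.
Hypothesis one_norm : ip one one = 1.
Hypothesis rho_bounded :
  forall i, exists2 C, 0 <= C & forall u : K, `|rho i u| <= C * `|u|.

Lemma rhoB i (u v : K) : rho i (u - v) = rho i u - rho i v.
Proof. by apply: ip_ext => w; rewrite rho_adj !ipBl !rho_adj. Qed.

Lemma commutes_rho_pair_compl T : commutes_rho_pair T T ->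
  commutes_rho_pair (fun u => u - T u) (fun u => u - T u).
Proof.
case=> aT [cT hT] _; suff c : commutes_rho (fun u => u - T u).
  by split=> // u v; rewrite pow_ipBl pow_ipBr aT.
split=> [i u|u Hu z]; first by apply/funext => z; rewrite cT /coordwise /= rhoB.
rewrite /= [_ z]addrC -scaleN1r; apply: K0_subspace.2 => //; exact: hT.
Qed.

Lemma optraceB T S : optrace (fun u => T u - S u) = optrace T - optrace S.
Proof. by rewrite /optrace -sumrB; apply: eq_bigr => z _; rewrite pow_ipBl. Qed.

Variable D : {pred Z}.

Definition cutoff u : Z -> K := fun z => if z \in D then u z else 0.

Lemma cutoff_projector : orth_projector cutoff.
Proof.
split=> [u v|u]; last by apply/funext => z; rewrite /cutoff; case: ifP => // ->.
apply: eq_bigr => z _; rewrite /cutoff; case: ifP => // _.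
by rewrite ip0l ip0r.
Qed.

Lemma cutoff_commutes : commutes_rho_pair cutoff cutoff.
Proof.
suff c : commutes_rho cutoff by split=> //; exact: cutoff_projector.1.
split=> [i u|u Hu z]; rewrite /cutoff.
  by apply/funext => z; rewrite /coordwise; case: ifP => // _; rewrite rho0.
by case: ifP => // _; exact: K0_subspace.1.
Qed.

Lemma optrace_cutoff : optrace cutoff = #|D|%:R.
Proof.
rewrite -sum1_card natr_sum [RHS]big_mkcond /=; apply: eq_bigr => z _.
rewrite -[X in pow_ip _ X]/(fun z' => if z' == z then one else 0).
rewrite pow_ipC -ip_one_at -ipC /cutoff /one_at eqxx.
by case: ifP; rewrite ?one_norm ?ip0l.
Qed.

(* tr(A^n P Q P) = tr(G^n Q P Q) telescopes to tr P - tr A^n P = tr Q - tr G^n Q,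
   for A = P (1 - Q) P and G = Q (1 - P) Q. *)
Lemma optrace_alternating P Q n :
  orth_projector P -> orth_projector Q ->
  commutes_rho_pair P P -> commutes_rho_pair Q Q ->
  let A := P \o (fun u => u - Q u) \o P in
  let G := Q \o (fun u => u - P u) \o Q in
  optrace P - optrace (iter n A \o P) = optrace Q - optrace (iter n G \o Q).
Proof.
move=> [aP PP] [aQ QQ] cP cQ A G.
have AA : adjoint A A by apply: PQP_adjoint => //; exact: orth_projector_compl.
have GA : adjoint G G by apply: PQP_adjoint => //; exact: orth_projector_compl.
have cG : commutes_rho_pair G G.
  have cP' := commutes_rho_pair_compl cP.
  exact: commutes_rho_pair_comp (commutes_rho_pair_comp cQ cP') cQ.
(* Both sides equal PQ - PQPQ, so PQ intertwines G and A. *)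
have APQ u : A (P (Q u)) = P (Q (G u)).
  rewrite /A /G /= PP QQ (adjointB _ _ aP) (adjointB _ _ aQ) QQ PP.
  by rewrite (adjointB _ _ aP).
have AnPQ m u : iter m A (P (Q u)) = P (Q (iter m G u)).
  by elim: m u => // m IHm u; rewrite !iterSr APQ IHm.
have step m : optrace (iter m A \o P) - optrace (iter m.+1 A \o P) =
    optrace (iter m G \o Q) - optrace (iter m.+1 G \o Q).
  rewrite -!optraceB.
  (* A^m P - A^(m+1) P = A^m PQP, as AP = P - PQP; by the intertwining this is PQ G^m QP. *)
  transitivity (optrace ((P \o Q) \o (iter m G \o (Q \o P)))).
    congr optrace; apply/funext => u; rewrite /= -AnPQ QQ -/(iter m.+1 A (P u)) iterSr.
    rewrite -(adjointB _ _ (adjoint_iter m AA)) /A /= !PP (adjointB _ _ aP) PP.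
    by rewrite opprB addrC subrK.
  (* Moving PQ to the other end leaves G^m QPQ, which is G^m Q - G^(m+1) Q by the symmetric
     computation. *)
  rewrite (optrace_comm (T' := Q \o P) (S' := (P \o Q) \o iter m G)); last first.
  - apply: commutes_rho_pair_comp; first exact: commutes_rho_pair_iter.
    exact: commutes_rho_pair_comp.
  - exact: commutes_rho_pair_comp.
  congr optrace; apply/funext => u; rewrite /= PP -/(iter m.+1 G (Q u)) iterSr.
  rewrite -(adjointB _ _ (adjoint_iter m GA)) /G /= !QQ (adjointB _ _ aQ) QQ.
  by rewrite opprB addrC subrK.
elim: n => [|n IHn]; first by rewrite !subrr.
rewrite -[LHS](subrKA (optrace (iter n A \o P))) IHn step.
by rewrite addrA subrK.
Qed.

Variable E : set (Z -> K).
Hypothesis E_sub : subspace E.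
Hypothesis E_K0 : forall w, E w -> forall z, K0 (w z).
Hypothesis E_rho : forall i w, E w -> E (coordwise (rho i) w).
Hypothesis E_inj :
  forall w, pow_closure E w -> (forall z, z \in D -> w z = 0) -> w = 0.

Lemma pow_closure_K0 w : pow_closure E w -> forall z, K0 (w z).
Proof.
move=> Ew z; apply/K0_closed/closure_normP => e e0; have [w' Ew' ww'] := Ew e e0.
by exists (w' z); [exact: E_K0|exact: ww'].
Qed.

Lemma pow_closure_rho i w :
  pow_closure E w -> pow_closure E (coordwise (rho i) w).
Proof.
move=> Ew e e0; have [C C0 iC] := rho_bounded i.
have C1 : 0 < C + 1 by rewrite ltr_wpDl.
have [w' Ew' ww'] := Ew _ (divr_gt0 e0 C1).
exists (coordwise (rho i) w') => [|z]; first exact: E_rho.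
rewrite /coordwise -rhoB; apply: le_lt_trans (iC _) _.
apply: (@le_lt_trans _ _ ((C + 1) * `|w z - w' z|)).
  by rewrite ler_wpM2r // lerDl.
by rewrite mulrC -ltr_pdivlMr.
Qed.

(** The closure of E is invariant under every [rho i], hence under its adjoint [rho (st i)]; a
    subspace that reduces an operator has a projector commuting with it. *)
Lemma commutes_rho_projector P : orth_projector P ->
  (forall u, pow_closure E (P u)) ->
  (forall b u, pow_closure E b -> pow_ip b (P u) = pow_ip b u) ->
  commutes_rho_pair P P.
Proof.
move=> [aP PP] PE Pb; suff c : commutes_rho P by [].
split=> [i u|u _]; last exact/pow_closure_K0/PE.
apply/eqP; rewrite -subr_eq0; apply/eqP/pow_ip_eq0.
set d := P _ - _; have Ed : pow_closure E d.
  rewrite /d addrC -scaleN1r; apply: (pow_closure_subspace E_sub).2 => //.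
  exact: pow_closure_rho.
have rho_pow v w :
    pow_ip v (coordwise (rho i) w) = pow_ip (coordwise (rho (st i)) v) w.
  by apply: eq_bigr => y _; rewrite rho_adj rho_stK.
rewrite {2}/d pow_ipBr Pb // !rho_pow Pb ?subrr //.
exact: pow_closure_rho.
Qed.

Lemma optrace_projector_le P : orth_projector P ->
  (forall u, pow_closure E (P u)) ->
  (forall b u, pow_closure E b -> pow_ip b (P u) = pow_ip b u) ->
  complex.Re (optrace P) <= #|D|%:R.
Proof.
move=> Pp PE Pb; have cP := commutes_rho_projector Pp PE Pb.
have Qp := cutoff_projector; have cQ := cutoff_commutes.
pose Q' u := u - cutoff u; have Q'p : orth_projector Q' := orth_projector_compl Qp.
have P'p := orth_projector_compl Pp.
(* P u = u puts u in the closure of E, while Q' u = u makes its coordinates in D vanish. *)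
have inj u : P u = u -> Q' u = u -> u = 0.
  move=> Pu Q'u; apply: E_inj => [|z zD]; first by rewrite -Pu.
  have /(congr1 (fun f => f z)) : cutoff u = 0.
    by rewrite -[LHS](subKr u) -/(Q' u) Q'u subrr.
  by rewrite /cutoff zD.
apply/ler_addgt0Pr => e e0.
(* The tolerance e is shared among the coordinates, with + 1 for an empty Z. *)
have d0 : 0 < e / (#|Z|%:R + 1) by rewrite divr_gt0 // ltr_wpDl.
have /boolp.choice[N NP] := fun z => PQP_iter_cvg0 Pp Q'p inj (P (one_at z)) d0.
pose n := (\sum_z N z)%N.
have := optrace_alternating (n + n) Pp Qp cP cQ; rewrite /= optrace_cutoff.
move/(congr1 (@complex.Re R)); rewrite !ReB.
have ReN k : complex.Re (k%:R : R[i]) = k%:R.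
  by rewrite -(rmorph_nat (real_complex R)).
rewrite ReN.
have trD : complex.Re (optrace (iter (n + n) (P \o Q' \o P) \o P)) <= e.
  rewrite /optrace Re_sum; apply: (@le_trans _ _ (\sum_(z : Z) (e / (#|Z|%:R + 1)))).
    apply: ler_sum => z _; rewrite /= PQP_iter_ip //=; apply/ltW/NP.
    by rewrite /n (bigD1 z) //= leq_addr.
  rewrite sumr_const -[leLHS]mulr_natr mulrAC ler_pdivrMr ?ltr_wpDl //.
  by rewrite mulrDr mulr1 lerDl ltW.
pose P' u := u - P u.
have trF : 0 <= complex.Re
    (optrace (iter (n + n) (cutoff \o P' \o cutoff) \o cutoff)).
  rewrite /optrace Re_sum sumr_ge0 // => z _; rewrite /= PQP_iter_ip //=.
  exact: pow_sqnorm_ge0.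
by move: trD trF; rewrite /Q' /P'; lra.
Qed.

(** W is not assumed closed, so the choice made by [orth_proj] may find no point and return 0. That
    case contributes 0, at most the nonnegative pairing given by P; otherwise the point found must
    be the value of P, because W lies between E and its closure. *)
Lemma orth_proj_trace_le W : E `<=` W -> W `<=` pow_closure E ->
  complex.Re (\sum_z pow_ip (orth_proj W (one_at z)) (one_at z)) <= #|D|%:R.
Proof.
move=> EW WE; have [P [Pp PE Pb]] := orth_projector_exists E_sub.
apply: le_trans (optrace_projector_le Pp PE Pb).
rewrite /optrace !Re_sum; apply: ler_sum => z _.
rewrite /orth_proj; case: xgetP => [p _ [Wp porth]|_]; last first.
  rewrite -[fun=> 0]/(0 : Z -> K) pow_ip0l orth_projector_sqnorm //=.
  exact: pow_sqnorm_ge0.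
suff -> : p = P (one_at z) by [].
apply/eqP; rewrite -subr_eq0; apply/eqP/pow_ip_eq0; set d := p - _.
have Ed : pow_closure E d.
  rewrite /d addrC -scaleN1r; apply: (pow_closure_subspace E_sub).2 => //.
  exact: WE.
have pd : pow_ip d (one_at z - p) = 0.
  by apply: pow_closure_orth Ed => b /EW Wb; rewrite pow_ipC porth // conjC0.
rewrite {2}/d pow_ipBr Pb // -opprB -pow_ipBr pd oppr0.
by [].
Qed.

End TracialFrame.

(** * Linear spans *)

(** Let s tend to u in |<s, u>| <= k |s|: the limit |u|^2 <= k |u| is then divided by |u|. *)
Lemma closure_norm_le (R : realType) (H : hilbertType R) (S : set H) u k :
  0 <= k -> closure S u -> (forall s, S s -> `|ip s u| <= k * `|s|) -> `|u| <= k.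
Proof.
move=> k0 Su Sk; have [->|u0] := eqVneq u 0; first by rewrite normr0.
have up : 0 < `|u| by rewrite normr_gt0.
rewrite -(ler_pM2r up); apply/ler_addgt0Pr => e e0.
have ku : 0 < k + `|u| by rewrite ltr_wpDl.
have [s Ss us] := (closure_normP _ _).1 Su _ (divr_gt0 e0 ku).
rewrite -expr2 -[leLHS]ger0_norm ?exprn_ge0 // -ip_norm.
have -> : ip u u = ip s u + ip (u - s) u by rewrite ipBl addrC subrK.
apply: le_trans (ler_normD _ _) _.
apply: le_trans (lerD (Sk s Ss) (ip_le_norm _ _)) _.
have ds : `|s| <= `|u| + `|u - s|.
  by rewrite -{1}(subKr u s); exact: ler_normB.
apply: (@le_trans _ _ (k * (`|u| + `|u - s|) + `|u - s| * `|u|)).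
  by rewrite lerD2r ler_wpM2l.
rewrite mulrDr -addrA lerD2l [k * _]mulrC -mulrDr -ler_pdivlMr //.
exact: ltW.
Qed.

Section Spans.
Context {R : realType} {H : hilbertType R}.
Implicit Types (S W : set H).

Lemma linear_span_sub S W : subspace W -> S `<=` W -> linear_span S `<=` W.
Proof.
case=> W0 WS SW _ [n [c [s [Ss ->]]]].
by elim/big_rec: _ => [//|i u _ Wu]; apply: WS => //; exact/SW/Ss.
Qed.

Lemma sub_linear_span S : S `<=` linear_span S.
Proof.
move=> u Su; exists 1%N, (fun=> 1), (fun=> u); split=> //.
by rewrite big_ord_recl big_ord0 addr0 scale1r.
Qed.

Lemma linear_span_subspace S : subspace (linear_span S).
Proof.
split.
  by exists 0%N, (fun=> 0), (fun=> 0); split=> [[]|] //; rewrite big_ord0.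
move=> c _ _ [n [a [s [Ss ->]]]] [m [b [t [St ->]]]].
exists (n + m)%N.
exists (fun i => if fintype.split i is inl j then c * a j else
                 if fintype.split i is inr j then b j else 0).
exists (fun i => match fintype.split i with inl j => s j | inr j => t j end).
split=> [i|]; first by case: fintype.split.
rewrite big_split_ord /= scaler_sumr; congr (_ + _); apply: eq_bigr => i _.
  by rewrite -[lshift _ _]/(unsplit (inl _)) unsplitK scalerA.
by rewrite -[rshift _ _]/(unsplit (inr _)) unsplitK.
Qed.

Lemma closure_subspace W : subspace W -> subspace (closure W).
Proof.
case=> W0 WS; split; first exact: subset_closure.
move=> c u v; move: v u.
have step1 s : W s -> forall u, closure W u -> closure W (c *: u + s).
  move=> Ws; apply: (@lipschitz_closure _ _ _ _ `|c|) => // [u v|u Wu].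
    by rewrite opprD addrACA subrr addr0 -scalerBr normrZ.
  by apply: subset_closure; exact: WS.
move=> v u Wu; move: v; apply: (@lipschitz_closure _ _ _ _ 1) => // [v w|v Wv].
  by rewrite opprD addrACA subrr add0r mul1r.
exact: step1.
Qed.

Lemma linear_span_eq0 S (F : H -> R[i]) C :
  (forall c u v, F (c *: u + v) = c * F u + F v) ->
  0 <= C -> (forall u, `|F u| <= C * `|u|) ->
  (forall u, S u -> F u = 0) -> forall u, closure (linear_span S) u -> F u = 0.
Proof.
move=> Fl C0 FC F0 u Su; apply: (@eq0_le_eps _ _ C) => e e0.
have [s Ss us] := (closure_normP _ _).1 Su e e0.
have Fs : F s = 0.
  apply: (@linear_span_sub S (fun v => F v = 0)) Ss => //.
  split=> [|c v w v0 w0]; last by rewrite Fl v0 w0 mulr0 addr0.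
  by have := Fl (-1) 0 0; rewrite scaler0 addr0 mulN1r addNr.
have -> : F u = F (u - s).
  by rewrite addrC -scaleN1r Fl Fs mulr0 add0r.
by apply: le_trans (FC _) _; rewrite ler_wpM2l // ltW.
Qed.

Lemma closure_span_sep S u : closure (linear_span S) u ->
  (forall s, S s -> ip u s = 0) -> u = 0.
Proof.
move=> Su uS; apply: ip_eq0.
apply: (@linear_span_eq0 S (fun w => ip w u) `|u|) => // [c v w|w|s Ss].
- by rewrite ipDl ipZl.
- by rewrite mulrC; exact: ip_le_norm.
by rewrite ipC uS // conjC0.
Qed.

Lemma norm_eq H' (u : H) (v : hilbert_sort H') : ip u u = ip v v -> `|u| = `|v|.
Proof.
by rewrite !ip_norm => /eqP; rewrite eqrXn2 // => /eqP.
Qed.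

End Spans.

(** * The tensor space of a tracial von Neumann algebra *)

Section StarAlgebra.
Context {R : realType} {M : tracial_vna R}.
Implicit Types a b : M.

Lemma act_ext a b : (forall u v, ip (vna_act a u) v = ip (vna_act b u) v) -> a = b.
Proof. by move=> ab; apply: act_inj; apply/funext => u; apply: ip_ext => v. Qed.

Lemma act_starr a u v : ip (vna_act (star a) u) v = ip u (vna_act a v).
Proof. by rewrite ipC -act_star -ipC. Qed.

Lemma starK a : star (star a) = a.
Proof. by apply: act_ext => u v; rewrite act_starr act_star. Qed.

Lemma starM a b : star (a * b) = star b * star a.
Proof. by apply: act_ext => u v; rewrite act_mul !act_starr act_mul. Qed.

Lemma star1 : star 1 = 1 :> M.
Proof. by apply: act_ext => u v; rewrite act_starr !act_one. Qed.

End StarAlgebra.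

Section TensorSpace.
Context {R : realType} {M : tracial_vna R} (K : L2_tensor M).
Implicit Types (a b x y : M) (u v w : K) (c : R[i]).

Lemma dense_tens u :
  closure (linear_span [set (tens p.1 p.2 : K) | p in setT]) u.
Proof. by rewrite tens_dense. Qed.

Lemma tens_sep u : (forall a b, ip u (tens a b) = 0) -> u = 0.
Proof. by move=> u0; apply: (closure_span_sep (@dense_tens u)) => _ [p _ <-]. Qed.

Lemma tens_ext u v : (forall a b, ip u (tens a b) = ip v (tens a b)) -> u = v.
Proof.
move=> uv; apply/eqP; rewrite -subr_eq0; apply/eqP/tens_sep => a b.
by rewrite ipBl uv subrr.
Qed.

Lemma tens_eq0 (F : K -> R[i]) C :
  (forall c u v, F (c *: u + v) = c * F u + F v) ->
  0 <= C -> (forall u, `|F u| <= C * `|u|) ->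
  (forall a b, F (tens a b) = 0) -> forall u, F u = 0.
Proof.
move=> Fl C0 FC F0 u; apply: (linear_span_eq0 Fl C0 FC _ (@dense_tens u)).
by move=> _ [p _ <-].
Qed.

Lemma lmultP x y c u v :
  lmult x y (c *: u + v) = c *: lmult x y u + lmult x y v :> K.
Proof. by have [l _] := lmult_bounded K x y; exact: l. Qed.

Lemma lmultr0 x y : lmult x y 0 = 0 :> K.
Proof.
by have := lmultP x y (-1) 0 0; rewrite scaler0 addr0 scaleN1r addNr.
Qed.

Lemma lmult_norm x y : exists2 C, 0 <= C & forall u, `|lmult x y u| <= C * `|u|.
Proof. exact/bounded_op_norm/lmult_bounded. Qed.

Lemma lmult_star_tens x y u (c d : M) :
  ip (lmult x y u) (tens c d) = ip u (lmult (star x) (star y) (tens c d)).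
Proof.
have [C C0 lC] := lmult_norm x y.
apply/eqP; rewrite -subr_eq0; apply/eqP; move: u.
set t : K := tens c d.
apply: (@tens_eq0 _ (C * `|t| + `|lmult (star x) (star y) t|)).
- by move=> e u v; rewrite lmultP !ipDl !ipZl; ring.
- by rewrite addr_ge0 // mulr_ge0.
- move=> u; apply: le_trans (ler_normB _ _) _; rewrite mulrDl lerD //.
    by apply: le_trans (ip_le_norm _ _) _; rewrite mulrAC ler_wpM2r.
  by rewrite mulrC ip_le_norm.
move=> a b; rewrite /t !lmult_tens !tens_ip !starM !starK !mulrA.
by rewrite -[tr (b * y * _)]tr_trace !mulrA subrr.
Qed.

(** Density is used one argument at a time: [lmult_star_tens] treats u through the bound on
    [lmult x y], and here v is treated through the bound on [lmult (star x) (star y)]. *)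
Lemma lmult_star x y u v : ip (lmult x y u) v = ip u (lmult (star x) (star y) v).
Proof.
have [C C0 lC] := lmult_norm (star x) (star y).
rewrite ipC [RHS]ipC; congr (_^*).
apply/esym/eqP; rewrite -subr_eq0; apply/eqP; move: v.
apply: (@tens_eq0 _ (C * `|u| + `|lmult x y u|)).
- by move=> e v w; rewrite lmultP !ipDl !ipZl; ring.
- by rewrite addr_ge0 // mulr_ge0.
- move=> v; apply: le_trans (ler_normB _ _) _; rewrite mulrDl lerD //.
    by apply: le_trans (ip_le_norm _ _) _; rewrite mulrAC ler_wpM2r.
  by rewrite mulrC ip_le_norm.
by move=> a b; rewrite ipC -lmult_star_tens -ipC subrr.
Qed.

Lemma lmultM x y x' y' u : lmult x y (lmult x' y' u) = lmult (x * x') (y' * y) u.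
Proof.
by apply: tens_ext => a b; rewrite !lmult_star !lmult_tens !starM !mulrA.
Qed.

(* The conjugation of K is only given on elementary tensors; Riesz's theorem
   extends it to K. *)
Lemma J_exists u : exists v, `|v| <= `|u| /\
  forall a b, ip (tens a b) v = ip u (tens (star a) (star b)).
Proof.
pose t (p : M * M) : K := tens p.1 p.2.
pose t' (p : M * M) : K := tens (star p.1) (star p.2).
pose f := @lin_ext R (M * M)%type R[i]^o (fun p => ip u (t' p)).
have tt' p q : ip (t' p) (t' q) = ip (t q) (t p).
  rewrite /t /t' !tens_ip !starK -[tr (_ * star p.1)]tr_trace; congr (_ * _).
  exact: tr_trace.
(* This bound also shows that f vanishes on the kernel of [lin_ext t], that is, respects the
   relations of the tensor product. The vector w is the image of p under the conjugation to be
   built, and [tt'] says that it has the right norm. *)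
have f_le p : `|f p| <= `|u| * `|lin_ext t p|.
  pose w := \sum_(k <- msupp p) (mcoeff k p)^* *: t' k.
  have -> : f p = ip u w.
    by rewrite ip_sumr; apply: eq_bigr => k _; rewrite ipZr conjCK.
  have <- : `|w| = `|lin_ext t p|; last exact: ip_le_norm.
  apply: norm_eq; rewrite !ip_suml [RHS](eq_bigr _ (fun k _ => ip_sumr _ _ _ _)).
  rewrite [LHS](eq_bigr _ (fun k _ => ip_sumr _ _ _ _)) exchange_big /=.
  apply: eq_bigr => k _; apply: eq_bigr => l _.
  by rewrite !ipZl !ipZr conjCK tt' mulrCA.
have [v vE fv] : exists2 v, closure (lin_ext t @` setT) v &
    forall p, setT p -> f p = ip (lin_ext t p) v.
  apply: (riesz (k := `|u|)) => //; first exact: lin_ext_is_linear.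
  by move=> c p q _ _; exact: lin_ext_is_linear.
exists v; split; last first.
  move=> a b; have := fv (mkmalgU (a, b) 1) I.
  by rewrite /f !lin_extU !scale1r.
apply: closure_norm_le vE _ => // _ [p _ <-].
by rewrite -fv.
Qed.

Definition Jop u : K := xget 0 [set v | `|v| <= `|u| /\
  forall a b, ip (tens a b) v = ip u (tens (star a) (star b))].

Lemma Jop_spec u : `|Jop u| <= `|u| /\
  forall a b, ip (tens a b) (Jop u) = ip u (tens (star a) (star b)).
Proof. by rewrite /Jop; case: xgetP => [_ _ //|] nJ; have [v /nJ] := J_exists u. Qed.

Lemma Jop_norm_le u : `|Jop u| <= `|u|.
Proof. exact: (Jop_spec u).1. Qed.

Lemma Jop_ip_tens u a b : ip (Jop u) (tens a b) = ip (tens (star a) (star b)) u.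
Proof. by rewrite ipC (Jop_spec u).2 -ipC. Qed.

Lemma Jop_tens a b : Jop (tens a b) = tens (star a) (star b).
Proof.
apply: tens_ext => c d; rewrite Jop_ip_tens !tens_ip.
by rewrite tr_trace; congr (_ * _); rewrite tr_trace.
Qed.

Lemma JopP c u v : Jop (c *: u + v) = c^* *: Jop u + Jop v.
Proof.
by apply: tens_ext => a b; rewrite ipDl ipZl !Jop_ip_tens ipDr ipZr.
Qed.

Lemma ip_Jop_sym u w : ip w (Jop u) = ip u (Jop w).
Proof.
apply/eqP; rewrite -subr_eq0; apply/eqP; move: w.
apply: (@tens_eq0 _ (`|u| + `|u|)) => [c v w||w|a b].
- by rewrite JopP ipDl ipZl ipDr ipZr conjCK; ring.
- by rewrite addr_ge0.
- apply: le_trans (ler_normB _ _) _; rewrite mulrDl lerD //.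
    by rewrite mulrC (le_trans (ip_le_norm _ _)) // ler_wpM2l // Jop_norm_le.
  by rewrite (le_trans (ip_le_norm _ _)) // ler_wpM2l // Jop_norm_le.
by rewrite ipC Jop_ip_tens -ipC Jop_tens subrr.
Qed.

Lemma JopK u : Jop (Jop u) = u.
Proof.
apply: tens_ext => a b; rewrite Jop_ip_tens ip_Jop_sym Jop_tens !starK.
by [].
Qed.

Lemma Jop_ip u v : ip (Jop u) (Jop v) = ip v u.
Proof. by rewrite ip_Jop_sym JopK. Qed.

Lemma JopB u v : Jop (u - v) = Jop u - Jop v.
Proof. by rewrite addrC -scaleN1r JopP rmorphN rmorph1 scaleN1r addrC. Qed.

(* The right multiplication by a (x) b^o: [L2_tensor] only provides the left one,
   so that its boundedness is obtained by conjugating with [Jop]. *)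
Definition rmult a b u : K := Jop (lmult (star a) (star b) (Jop u)).

Lemma rmult_tens a b x y : rmult a b (tens x y) = tens (x * a) (b * y).
Proof. by rewrite /rmult Jop_tens lmult_tens Jop_tens !starM !starK. Qed.

Lemma rmult_star a b u v : ip (rmult a b u) v = ip u (rmult (star a) (star b) v).
Proof.
by rewrite /rmult -{1}(JopK v) Jop_ip [RHS]ip_Jop_sym lmult_star !starK.
Qed.

Lemma rmultP a b c u v : rmult a b (c *: u + v) = c *: rmult a b u + rmult a b v.
Proof. by rewrite /rmult JopP lmultP JopP conjCK. Qed.

Lemma rmult_norm a b : exists2 C, 0 <= C & forall u, `|rmult a b u| <= C * `|u|.
Proof.
have [C C0 lC] := lmult_norm (star a) (star b); exists C => // u.
apply: le_trans (Jop_norm_le _) _; apply: le_trans (lC _) _.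
by rewrite ler_wpM2l // Jop_norm_le.
Qed.

Lemma rmult_lmult a b x y u : rmult a b (lmult x y u) = lmult x y (rmult a b u).
Proof.
apply: tens_ext => c d; rewrite rmult_star !lmult_star rmult_tens.
by rewrite rmult_star !lmult_tens rmult_tens !mulrA.
Qed.

Section Subalgebra.
Variable A : set M.
Hypothesis A_alg : unital_star_subalgebra A.
Local Notation AA := (@L2_alg_tensor R M K A).

Lemma alg_tensor_subspace : subspace (AA).
Proof. exact/closure_subspace/linear_span_subspace. Qed.

Lemma alg_tensor_closed : closure AA `<=` AA.
Proof. exact: closed_closure. Qed.

Lemma alg_tensor_tens a b : A a -> A b -> AA (tens a b).
Proof.
by move=> Aa Ab; apply/subset_closure/sub_linear_span; exists (a, b).
Qed.

Lemma alg_tensor_sep u : AA u ->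
  (forall a b, A a -> A b -> ip u (tens a b) = 0) -> u = 0.
Proof.
move=> Au u0; apply: closure_span_sep (Au) _ => _ [[a b] /= [Aa Ab] <-].
exact: u0.
Qed.

Lemma alg_tensor_stable (T : K -> K) C :
  0 <= C -> (forall u v, `|T u - T v| <= C * `|u - v|) ->
  subspace (fun u => AA (T u)) ->
  (forall a b, A a -> A b -> AA (T (tens a b))) ->
  forall u, AA u -> AA (T u).
Proof.
move=> C0 TC Ts Tt; apply: (lipschitz_closure C0 TC).
by apply: linear_span_sub => // _ [[a b] /= [Aa Ab] <-]; exact: Tt.
Qed.

Lemma Jop_alg_tensor u : AA u -> AA (Jop u).
Proof.
have [_ _ _ AS] := A_alg; have [K0 KS] := alg_tensor_subspace; move: u.
apply: (@alg_tensor_stable _ 1) => // [u v||a b Aa Ab].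
- by rewrite mul1r -JopB Jop_norm_le.
- split=> [|c u v Ju Jv]; last by rewrite JopP; exact: KS.
  by rewrite -[0](subrr 0) JopB subrr.
by rewrite Jop_tens; apply: alg_tensor_tens; exact: AS.
Qed.

Lemma linear_alg_tensor (T : K -> K) :
  (forall c u v, T (c *: u + v) = c *: T u + T v) ->
  (exists2 C, 0 <= C & forall u, `|T u| <= C * `|u|) ->
  (forall a b, A a -> A b -> AA (T (tens a b))) ->
  forall u, AA u -> AA (T u).
Proof.
move=> Tl [C C0 TC] Tt; have [K0 KS] := alg_tensor_subspace.
apply: (@alg_tensor_stable _ C) => // [u v|].
  by rewrite [T u - T v]addrC -scaleN1r -Tl scaleN1r addrC.
split=> [|c u v Tu Tv]; last by rewrite Tl; exact: KS.
have := Tl (-1) 0 0; rewrite scaler0 addr0 scaleN1r addNr => ->.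
exact: K0.
Qed.

Lemma rmult_alg_tensor a b u : A a -> A b ->
  AA u -> AA (rmult a b u).
Proof.
move=> Aa Ab; have [_ _ AM _] := A_alg; move: u; apply: linear_alg_tensor.
- exact: rmultP.
- exact: rmult_norm.
by move=> x y Ax Ay; rewrite rmult_tens; apply: alg_tensor_tens; exact: AM.
Qed.

End Subalgebra.

End TensorSpace.

(** * Derivations *)

Section Derivations.
Context {R : realType} {M : tracial_vna R} (L : L2_space M) (K : L2_tensor M).
Implicit Types (a b x y : M) (u v w : K) (c : R[i]) (delta : M -> K).

Lemma norm_tens_l a : `|tens a 1 : K| = `|vec a : L|.
Proof. by apply: norm_eq; rewrite tens_ip vec_ip star1 mul1r tr_one mulr1. Qed.

Lemma norm_tens_r a : `|tens 1 a : K| = `|vec a : L|.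
Proof.
by apply: norm_eq; rewrite tens_ip vec_ip star1 mul1r tr_one mul1r tr_trace.
Qed.

Lemma norm_vec_star a : `|vec (star a) : L| = `|vec a : L|.
Proof. by apply: norm_eq; rewrite !vec_ip starK tr_trace. Qed.

(** The bound is read off from [lmult x 1] on the isometric copy a |-> a (x) 1 of L^2(M) in K. *)
Lemma norm_vec_mull x : exists2 C, 0 <= C & forall a,
  `|vec (x * a) : L| <= C * `|vec a : L|.
Proof.
have [C C0 xC] := lmult_norm K x 1; exists C => // a.
by have := xC (tens a 1); rewrite lmult_tens mul1r !norm_tens_l.
Qed.

Lemma norm_vec_mulr x : exists2 C, 0 <= C & forall a,
  `|vec (a * x) : L| <= C * `|vec a : L|.
Proof.
have [C C0 xC] := lmult_norm K 1 x; exists C => // a.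
by have := xC (tens 1 a); rewrite lmult_tens mul1r !norm_tens_r.
Qed.

Section OnSubalgebra.
Variable A : set M.
Hypothesis A_alg : unital_star_subalgebra A.
Local Notation AA := (@L2_alg_tensor R M K A).

Lemma alg_subspace : subspace A.
Proof.
have [A1 AZ _ _] := A_alg; split=> //.
by have := AZ (-1) 1 1 A1 A1; rewrite scaleN1r addNr.
Qed.

Lemma L2_alg_subspace : subspace (@L2_alg R M L A).
Proof.
have [A0 AZ] := alg_subspace; apply: closure_subspace; split.
  by exists 0 => //; rewrite linear0.
move=> c _ _ [a Aa <-] [b Ab <-].
by exists (c *: a + b); rewrite ?linearP //; exact: AZ.
Qed.

(** In the Leibniz expansion of delta at p^* a q^*, the middle term p^* . delta(a) . q^* pairs with
    1 (x) 1 as delta(a) does with p (x) q. Of the other terms, one has 1 (x) 1 in the pairing, where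
    delta^* is available, and two have delta at elements independent of a. *)
Lemma derivation_sandwich delta (p q : M) a : derivation A delta ->
  A p -> A q -> A a ->
  ip (delta a) (tens p q) =
    ip (delta (star p * a * star q)) (tens 1 1)
    - ip (delta (star q)) (tens (star a * p) 1)
    - ip (delta (star p)) (tens 1 (q * star a)).
Proof.
have [_ _ AM AS] := A_alg.
case=> _ _ dM Ap Aq Aa; rewrite !dM //; try exact: AS; last exact/AM/Aa/AS.
have lmultD x y u v : lmult x y (u + v) = lmult x y u + lmult x y v.
  by rewrite -[u]scale1r lmultP !scale1r.
rewrite lmultD !lmultM !mul1r !ipDl !lmult_star !lmult_tens.
by rewrite !starM !starK star1 !mulr1 !mul1r; ring.
Qed.

(* By [derivation_sandwich] the pairing is a bounded functional of [vec a]. *)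
Lemma Der11_dom_adjoint delta (p q : M) : Der11 L A delta -> A p -> A q ->
  dom_adjoint L A delta (tens p q).
Proof.
case=> dd [_ [xi0 _ xi0P]] Ap Aq; have [_ _ AM AS] := A_alg.
split; first exact: alg_tensor_tens.
have [C1 C10 h1] := norm_vec_mull (star p).
have [C2 C20 h2] := norm_vec_mulr (star q).
have [C3 C30 h3] := norm_vec_mulr p.
have [C4 C40 h4] := norm_vec_mull q.
have dl : linear_on A (fun a => ip (delta a) (tens p q : K)).
  by case: dd => _ dZ _ c a b Aa Ab; rewrite dZ // ipDl ipZl.
have vecP c a b : vec (c *: a + b) = c *: vec a + vec b :> L by rewrite linearP.
(* One summand for each term of [derivation_sandwich]; xi0 is the value of delta^* at 1 (x) 1. *)
pose k := C2 * C1 * `|xi0| + `|delta (star q)| * C3 + `|delta (star p)| * C4.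
have [//|a Aa|xi xiA xiP] := riesz vecP alg_subspace dl (_ : 0 <= k).
- by rewrite !addr_ge0 ?mulr_ge0.
- rewrite derivation_sandwich // xi0P; last by apply/(AM _ _ _ (AS _ Aq))/AM/Aa/AS.
  rewrite !mulrDl; apply: le_trans (ler_normB _ _) _; apply: lerD.
    apply: le_trans (ler_normB _ _) _; apply: lerD.
      apply: le_trans (ip_le_norm _ _) _; rewrite mulrAC ler_wpM2r //.
      by apply: le_trans (h2 _) _; rewrite -mulrA ler_wpM2l.
    apply: le_trans (ip_le_norm _ _) _; rewrite norm_tens_l -mulrA ler_wpM2l //.
    by apply: le_trans (h3 _) _; rewrite norm_vec_star.
  apply: le_trans (ip_le_norm _ _) _; rewrite norm_tens_r -mulrA ler_wpM2l //.
  by apply: le_trans (h4 _) _; rewrite norm_vec_star.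
by exists xi.
Qed.

(** Right multiplication commutes with the bimodule actions, hence preserves the Leibniz rule. Its
    adjoint sends 1 (x) 1 to p^* (x) q^*, which [Der11_dom_adjoint] places in the domain of
    delta^*. *)
Lemma Der11_rmult delta (p q : M) : Der11 L A delta -> A p -> A q ->
  Der11 L A (fun a => rmult p q (delta a)).
Proof.
move=> dD Ap Aq; have [[dA dZ dM] [A11 _]] := dD; have [_ _ AM AS] := A_alg.
split; [split|split=> //].
- by move=> a Aa; apply: rmult_alg_tensor => //; exact: dA.
- by move=> c a b Aa Ab; rewrite dZ // rmultP.
- move=> a b Aa Ab; rewrite dM //.
  by rewrite -[lmult a 1 _]scale1r rmultP !rmult_lmult scale1r.
have [_ [xi xiA xiP]] := Der11_dom_adjoint dD (AS _ Ap) (AS _ Aq).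
by exists xi => // a Aa; rewrite rmult_star rmult_tens mul1r mulr1 xiP.
Qed.

Lemma Der11_0 : Der11 L A (fun=> 0 : K).
Proof.
have [A1 _ _ _] := A_alg.
split; [split=> [a _|c a b _ _|a b _ _]|split].
- exact: (alg_tensor_subspace K A).1.
- by rewrite scaler0 addr0.
- by rewrite !lmultr0 addr0.
- exact: alg_tensor_tens.
by exists 0; [exact: L2_alg_subspace.1|move=> a _; rewrite ip0l ip0r].
Qed.

Lemma Der11P c (d1 d2 : M -> K) : Der11 L A d1 -> Der11 L A d2 ->
  Der11 L A (fun a => c *: d1 a + d2 a).
Proof.
move=> [[A1 Z1 M1] [t11 [xi1 L1 x1]]] [[A2 Z2 M2] [_ [xi2 L2 x2]]].
split; [split=> [a Aa|e a b Aa Ab|a b Aa Ab]|split=> //].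
- by apply: (alg_tensor_subspace K A).2; [exact: A1|exact: A2].
- rewrite Z1 // Z2 // !scalerDr !scalerA [c * e]mulrC -!addrA.
  by congr (_ + _); rewrite addrCA.
- by rewrite M1 // M2 // !lmultP scalerDr addrACA.
exists (c^* *: xi1 + xi2); first exact: L2_alg_subspace.2.
by move=> a Aa; rewrite ipDl ipZl ipDr ipZr conjCK x1 // x2.
Qed.

End OnSubalgebra.

End Derivations.

(** * The free gradient *)

Section Gradient.
Context {R : realType} {M : tracial_vna R} (L : L2_space M) (K : L2_tensor M).
Variable X : {fset M}.
Implicit Types (a b : M) (u v : K) (c : R[i]) (delta : M -> K).

Lemma gen_alg_subalgebra : unital_star_subalgebra (gen_alg X).
Proof.
split=> [B [[]]//|c a b Aa Ab B hB|a b Aa Ab B hB|a Aa B hB].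
- by have [[_ BZ _ _] _] := hB; apply: BZ; [exact: Aa|exact: Ab].
- by have [[_ _ BM _] _] := hB; apply: BM; [exact: Aa|exact: Ab].
- by have [[_ _ _ BS] _] := hB; apply: BS; exact: Aa.
Qed.

Lemma sub_gen_alg x : x \in X -> gen_alg X x.
Proof. by move=> Xx B [_]; apply. Qed.

Variable A : set M.
Hypothesis A_alg : unital_star_subalgebra A.
Hypothesis XA : forall x, x \in X -> A x.

Definition seq_eval (s : seq X) : M := \prod_(x <- s) val x.

Lemma seq_eval_alg s : A (seq_eval s).
Proof.
have [A1 _ AM _] := A_alg; rewrite /seq_eval.
by elim/big_rec: _ => // x m _ Am; apply: AM => //; exact/XA/valP.
Qed.

Lemma eval_alg (p : free_alg R X) : A (Defs.eval p).
Proof.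
have [A0 AZ] := alg_subspace A_alg; rewrite /Defs.eval /lin_ext.
by elim/big_rec: _ => // w m _ Am; apply: AZ => //; exact: seq_eval_alg.
Qed.

Lemma lmult_sum x y I (r : seq I) (P : pred I) (F : I -> K) :
  lmult x y (\sum_(i <- r | P i) F i) = \sum_(i <- r | P i) lmult x y (F i).
Proof.
elim/big_rec2: _ => [|i v u _ <-]; first exact: lmultr0.
by rewrite -[F i]scale1r lmultP !scale1r.
Qed.

Lemma derivation1 delta : derivation A delta -> delta 1 = 0.
Proof.
have [A1 _ _ _] := A_alg.
have lmult11 (u : K) : lmult 1 1 u = u.
  by apply: tens_ext => a b; rewrite lmult_star lmult_tens star1 mul1r mulr1.
case=> _ _ dM; have := dM 1 1 A1 A1; rewrite mulr1 lmult11.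
by move/(congr1 (fun v => v - delta 1)); rewrite subrr addrK.
Qed.

Lemma derivation_word delta (s : seq X) : derivation A delta ->
  delta (seq_eval s) = \sum_(i < size s)
    lmult (seq_eval (take i s)) (seq_eval (drop i.+1 s))
      (delta (val (tnth (in_tuple s) i))).
Proof.
move=> dd; have [_ _ dM] := dd; elim: s => [|x s IHs].
  by rewrite big_ord0 /seq_eval big_nil derivation1.
rewrite {1}/seq_eval big_cons -/(seq_eval s) dM //; last exact: seq_eval_alg.
  rewrite IHs lmult_sum big_ord_recl /= addrC drop0.
  rewrite [seq_eval [::]]big_nil (tnth_nth x) /=; congr (_ + _).
  apply: eq_bigr => i _; rewrite lmultM mulr1 !(tnth_nth x) /=.
  by rewrite /bump /= add1n [seq_eval (x :: _)]big_cons.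
exact/XA/valP.
Qed.

(* The value at [s] of the bilinear map u (x) v^o, zeta |-> u . zeta . v. *)
Definition tens_act (s : free_tens R X) (zeta : K) : K :=
  lin_ext (fun k => lmult (eval_word k.1) (eval_word k.2) zeta) s.

(** Chain rule. On a word, grouping the positions of the Leibniz expansion by the letter they carry
    yields the difference quotients. *)
Lemma derivation_eval delta (p : free_alg R X) : derivation A delta ->
  delta (Defs.eval p) = \sum_(x : X) tens_act (fdq x p) (delta (val x)).
Proof.
move=> dd; have [_ dZ _] := dd; have [A1 _ _ _] := A_alg.
have -> : delta (Defs.eval p) = lin_ext (fun w => delta (eval_word w)) p.
  have [A0 AZ] := alg_subspace A_alg.
  have d0 : delta 0 = 0.
    have := dZ (-1) 0 0 A0 A0; rewrite scaler0 addr0 scaleN1r addNr.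
    by [].
  rewrite /Defs.eval /lin_ext; set m := \sum_(k <- msupp p) _.
  (* delta is linear on A only, so membership of the partial sums in A is proved along with the
     formula. *)
  suff [] : A m /\ delta m = \sum_(k <- msupp p) mcoeff k p *: delta (eval_word k).
    by [].
  rewrite {}/m.
  elim/big_rec2: _ => [//|w m u _ [Am <-]]; split.
    by apply: AZ => //; exact: seq_eval_alg.
  by rewrite dZ //; exact: seq_eval_alg.
have -> : \sum_(x : X) tens_act (fdq x p) (delta (val x)) =
    lin_ext (fun w => \sum_(x : X) tens_act (fdq_word x w) (delta (val x))) p.
  rewrite /lin_ext /=; transitivity (\sum_(x : X) \sum_(k <- msupp p)
      mcoeff k p *: tens_act (fdq_word x k) (delta (val x))).
    by apply: eq_bigr => x _; rewrite /tens_act /fdq lin_ext_comp.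
  by rewrite exchange_big /=; apply: eq_bigr => k _; rewrite scaler_sumr.
congr lin_ext; apply/funext => w; rewrite [LHS](derivation_word w dd).
transitivity (\sum_(x : X) \sum_(i < size w | nth x w i == x)
    lmult (seq_eval (take i w)) (seq_eval (drop i.+1 w)) (delta (val x))).
  rewrite (exchange_big_dep predT) //=; apply: eq_bigr => i _.
  have wi x : nth x w i = tnth (in_tuple w) i by rewrite (tnth_nth x).
  rewrite (eq_bigl (pred1 (tnth (in_tuple w) i))) ?big_pred1_eq // => x.
  by rewrite wi eq_sym.
apply: eq_bigr => x _; rewrite /tens_act /fdq_word linear_sum /=.
by apply: eq_bigr => i _; rewrite lin_extU scale1r.
Qed.

(** Traciality: in the trace of (p (x) q)^* s zeta, the first factor is moved to the right end,
    which leaves s paired with the conjugate of zeta (p (x) q)^*. *)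
Lemma ip_tens_act s zeta (p q : M) :
  ip (tens_act s zeta) (tens p q) =
  ip (eval_tens K s) (Jop (rmult (star p) (star q) zeta)).
Proof.
rewrite /tens_act /eval_tens /lin_ext !ip_suml; apply: eq_bigr => k _.
rewrite !ipZl; congr (_ * _).
rewrite ip_Jop_sym Jop_tens rmult_star !starK rmult_tens.
by rewrite lmult_star lmult_tens.
Qed.

(* Pairing with p (x) q^o moves the unbounded coefficient d_x p(X) to the second
   argument, so the identity survives the closure of the free gradient. *)
Lemma Der11_gradient y (p q : M) : A p -> A q -> A y ->
  dom_free_gradient_closure L K X (vec y) ->
  exists g : X -> K, forall delta, Der11 L A delta ->
    ip (delta y) (tens p q) = \sum_(x : X) ip (delta (val x)) (g x).
Proof.
(* eta is a value of the closed gradient at y. The conjugation and the right multiplication are put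
   on eta rather than on delta(x), so that the witness does not depend on delta. *)
move=> Ap Aq Ay [eta etaP]; exists (fun x => rmult p q (Jop (eta x))) => delta dD.
have dd := dD.1; have [_ [xi _ xiP]] := Der11_dom_adjoint A_alg dD Ap Aq.
pose J (x : X) := Jop (rmult (star p) (star q) (delta (val x))).
transitivity (\sum_(x : X) ip (eta x) (J x)); last first.
  apply: eq_bigr => x _; rewrite /J ip_Jop_sym rmult_star.
  by rewrite !starK.
apply/eqP; rewrite -subr_eq0; apply/eqP.
apply: (@eq0_le_eps _ _ (`|xi| + \sum_x `|J x|)) => e e0.
have [_ [r _ <-] [/= re ge]] := etaP e e0.
(* xi is delta^* of p (x) q: the error at y - r(X) becomes a pairing with xi, and the error on the
   gradients a pairing with the vectors J x. *)
have -> : ip (delta y) (tens p q) - \sum_x ip (eta x) (J x) =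
    \sum_x ip (eval_tens K (fdq x r) - eta x) (J x)
    - ip (vec (Defs.eval r) - vec y : L) xi.
  rewrite ipBl -!xiP //; last exact: eval_alg.
  have -> : ip (delta (Defs.eval r)) (tens p q) =
      \sum_(x : X) ip (eval_tens K (fdq x r)) (J x).
    rewrite derivation_eval // ip_suml; apply: eq_bigr => x _.
    by rewrite ip_tens_act.
  rewrite (eq_bigr _ (fun x _ => ipBl _ _ _)) sumrB; ring.
apply: le_trans (ler_normB _ _) _; rewrite mulrDl addrC lerD //.
  apply: le_trans (ip_le_norm _ _) _; rewrite mulrC ler_wpM2l //; exact: ltW.
rewrite mulr_suml; apply: le_trans (ler_norm_sum _ _ _) _.
apply: ler_sum => x _; apply: le_trans (ip_le_norm _ _) _.
rewrite mulrC ler_wpM2l //; apply: le_trans (ltW ge).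
exact: (norm_coord_le_pow (fun x => eval_tens K (fdq x r) - eta x)).
Qed.

End Gradient.

(** * The dimension bound for the algebra generated by X and Y *)

Lemma pow_ip_sumr (R : realType) (K : hilbertType R) (Z I : finType)
    (w : Z -> K) (F : I -> Z -> K) :
  pow_ip w (\sum_i F i) = \sum_i pow_ip w (F i).
Proof. exact: (big_morph (pow_ip w) (fun u v => pow_ipDr u v w) (pow_ip0r w)). Qed.

Lemma pow_ip_single (R : realType) (K : hilbertType R) (Z : finType)
    (w : Z -> K) z (v : K) :
  pow_ip w (fun z' => if z' == z then v else 0) = ip (w z) v.
Proof. by rewrite pow_ipC -ip_one_at -ipC. Qed.

Section Bound.
Context {R : realType} {M : tracial_vna R} (L : L2_space M) (K : L2_tensor M).
Variables X Y : {fset M}.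
Local Notation Z := (X `|` Y)%fset.
Local Notation B := (gen_alg Z).
Hypothesis Y_dom : forall y, y \in Y -> dom_free_gradient_closure L K X (vec y).

Local Notation E := (@phi R M K Z @` Der11 L B).

Let B_alg : unital_star_subalgebra B := gen_alg_subalgebra Z.
Let ZB z : z \in Z -> B z := @sub_gen_alg R M Z z.

Lemma XB x : x \in X -> B x.
Proof. by move=> Xx; apply: ZB; rewrite inE Xx. Qed.

Lemma phi_Der11_subspace : subspace E.
Proof.
split; first by exists (fun=> 0) => //; exact: Der11_0.
move=> c _ _ [d1 D1 <-] [d2 D2 <-].
by exists (fun a => c *: d1 a + d2 a) => //; exact: Der11P.
Qed.

Lemma phi_Der11_closure_inj w : pow_closure E w ->
  (forall z : Z, val z \in X -> w z = 0) -> w = 0.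
Proof.
move=> Ew wX; apply/funext => z.
have [Xz|nXz] := boolP (val z \in X); first exact: wX.
have Yz : val z \in Y by have := valP z; rewrite inE (negPf nXz).
apply: (@alg_tensor_sep R M K B).
  apply/alg_tensor_closed/closure_normP => e e0.
  have [_ [d [[dB _ _] _] <-] wd] := Ew e e0.
  by exists (d (val z)); [exact: dB (ZB (valP z))|exact: wd].
move=> p q Bp Bq; have Bz : B (val z) := ZB (valP z).
have [g gP] := Der11_gradient B_alg XB Bp Bq Bz (Y_dom Yz).
pose inZ (x : X) : Z := fincl (fsubsetUl X Y) x.
(* The relation between the coordinate z and those in X becomes orthogonality to the single vector
   g', a condition that passes from E to its closure. *)
pose g' : Z -> K := (fun z' => if z' == z then tens p q else 0)
  - \sum_(x : X) (fun z' => if z' == inZ x then g x else 0).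
have g'E u : pow_ip u g' = ip (u z) (tens p q) - \sum_(x : X) ip (u (inZ x)) (g x).
  rewrite pow_ipBr pow_ip_single pow_ip_sumr; congr (_ - _).
  by apply: eq_bigr => x _; rewrite pow_ip_single.
have : pow_ip w g' = 0.
  apply: pow_closure_orth Ew => _ [d dD <-]; rewrite g'E /phi gP //.
  apply/eqP; rewrite subr_eq0; apply/eqP; apply: eq_bigr => x _.
  by [].
rewrite g'E big1 ?subr0 // => x _; rewrite wX ?ip0l //.
exact: fsvalP.
Qed.

Lemma free_stein_dim_le : free_stein_dim L K B Z <= #|` X|%:R.
Proof.
pose D := [pred z : Z | val z \in X].
have D_le : (#|D|%:R : R) <= #|` X|%:R.
  rewrite ler_nat cardE -(size_map val) uniq_leq_size //.
    by rewrite map_inj_uniq ?enum_uniq //; exact: val_inj.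
  by move=> x /mapP[z]; rewrite mem_enum => Xz ->.
apply: le_trans D_le; rewrite /free_stein_dim /vn_dim.
have [B1 _ BM BS] := B_alg.
(* Pairs are restricted to B: right multiplication by them preserves L^2(B (x) B^o) and E, and still
   moves 1 (x) 1 over a total set. *)
pose I := {p : M * M | B p.1 /\ B p.2}.
pose rho (i : I) (u : K) := rmult (sval i).1 (sval i).2 u.
pose st (i : I) : I := exist _ (star (sval i).1, star (sval i).2)
  (conj (BS _ (svalP i).1) (BS _ (svalP i).2)).
apply: (@orth_proj_trace_le R K _ I rho st (@Jop R M K) (tens 1 1)
  (L2_alg_tensor B) _ _ _ _ _ _ _ _ _ _ _ D E).
- by move=> i u v; rewrite /rho rmult_star.
- by move=> i u; rewrite /rho /= !starK.
- exact: Jop_ip.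
- by move=> i; rewrite /rho !rmult_tens Jop_tens /= !mul1r !mulr1 !starK.
- exact: alg_tensor_subspace.
- exact: alg_tensor_tens.
- exact: Jop_alg_tensor.
- move=> u Bu u0; apply: (alg_tensor_sep Bu) => a b Ba Bb.
  have := u0 (exist _ (a, b) (conj Ba Bb)).
  by rewrite /rho rmult_tens /= mul1r mulr1.
- exact: alg_tensor_closed.
- by rewrite tens_ip star1 !mulr1 tr_one mulr1.
- by move=> i; exact: rmult_norm.
- exact: phi_Der11_subspace.
- by move=> _ [d [[dB _ _] _] <-] z; exact: dB (ZB (valP z)).
- move=> [[p q] [Bp Bq]] _ [d dD <-].
  by exists (fun a => rmult p q (d a)) => //; exact: Der11_rmult.
- by move=> w Ew wD; apply: phi_Der11_closure_inj => // z Xz; exact: wD.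
- move=> _ [d dD <-]; exists d => //; split; first exact: dD.1.
  move=> e e0; exists d => //; rewrite /pow_norm big1 ?sqrtC0 // => z _.
  by rewrite /= subrr normr0 expr0n.
move=> _ [d [_ dC] <-] e e0; have [d' d'D dd'] := dC e e0.
exists (phi d'); first by exists d'.
move=> z; apply: le_lt_trans dd'.
exact: (norm_coord_le_pow (phi d \- phi d' : Z -> K) z).
Qed.

End Bound.

Theorem theorem3p6 (R : realType) (M : tracial_vna R)
    (L : L2_space M) (K : L2_tensor M) (X : {fset M}) :
  selfadjoint_fset X ->
  free_stein_dim L K (gen_alg X) X = #|` X|%:R ->
  forall Y : {fset M},
    selfadjoint_fset Y ->
    (forall y, y \in Y ->
      dom_free_gradient_closure L K X (vec y) /\ gen_vna X y) ->
    free_stein_dim L K (gen_alg (X `|` Y)%fset) (X `|` Y)%fset <= #|` X|%:R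
    /\ #|` X|%:R = free_stein_dim L K (gen_alg X) X.
Proof.
move=> _ sigmaX Y _ Y_dom; split; last by rewrite sigmaX.
by apply: free_stein_dim_le => y /Y_dom[].
Qed.
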